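(* The diagram $\vec{D}^{\mathrm{u}}$ can be lifted, with respect to the functor $\mathrm{V}^1$, by a commutative diagram of unital C*-algebras and unital C*-homomorphisms. That is, there is a $\{0,1\}^3$-indexed commutative diagram $\vec{R}$ of unital C*-algebras and unital C*-homomorphisms such that $\mathrm{V}^1\vec{R}$ is naturally isomorphic to $\vec{D}^{\mathrm{u}}$ as a diagram of monoids with order-unit.
   Context: $\mathbb{Z}^+=\{0,1,2,\dots\}$. The diagram $\vec{D}^{\mathrm{u}}$ is the commutative diagram of commutative monoids with order-unit (morphisms being monoid homomorphisms preserving the distinguished order-units), indexed by the cube $\{0,1\}^3$, with bottom vertex $(\boldsymbol{A},1)$, top vertex $(\boldsymbol{B},2)$, where $\boldsymbol{A}=\boldsymbol{B}=\mathbb{Z}^+$, and middle vertices $(\boldsymbol{A}_j,(1,1))$, $(\boldsymbol{B}_j,(1,1))$, where $\boldsymbol{A}_j=\boldsymbol{B}_j=\mathbb{Z}^+\times\mathbb{Z}^+$, $j\in\{0,1,2\}$. Let $\boldsymbol{e}(x)=(x,x)$, $\boldsymbol{s}(x,y)=(y,x)$, $\boldsymbol{h}(x,y)=x+y$. The arrows are: $\boldsymbol{e}\colon\boldsymbol{A}\to\boldsymbol{A}_j$ for each $j$; the identity maps $\boldsymbol{A}_0\to\boldsymbol{B}_2$, $\boldsymbol{A}_0\to\boldsymbol{B}_1$, $\boldsymbol{A}_1\to\boldsymbol{B}_0$, $\boldsymbol{A}_2\to\boldsymbol{B}_1$, $\boldsymbol{A}_2\to\boldsymbol{B}_0$; the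 map $\boldsymbol{s}\colon\boldsymbol{A}_1\to\boldsymbol{B}_2$; and $\boldsymbol{h}\colon\boldsymbol{B}_j\to\boldsymbol{B}$ for each $j$. For a ring $R$, $\mathrm{V}(R)$ is the commutative monoid of equivalence classes $[a]_R$ of idempotents $a$ of $\mathrm{M}_\infty(R)=\bigcup_n\mathrm{M}_n(R)$ (embedding $\mathrm{M}_n(R)$ into $\mathrm{M}_{n+1}(R)$ by adding a zero row and column), where $a\sim b$ if $a=xy$, $b=yx$ for some $x,y\in\mathrm{M}_\infty(R)$, with addition determined by $[a]_R+[b]_R=[a+b]_R$ whenever $ab=ba=0$. A ring homomorphism $f\colon R\to S$ induces $\mathrm{V}(f)\colon[a]_R\mapsto[f(a)]_S$. For unital $R$, $\mathrm{V}^1(R)=(\mathrm{V}(R),[1_R])$. *)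

(* Defs.v *)
From HB Require Import structures.
From mathcomp Require Import all_boot all_order all_algebra.
From mathcomp Require Import all_classical all_reals topology normedtype.
From mathcomp Require Import complex.

Set Implicit Arguments.
Unset Strict Implicit.
Unset Printing Implicit Defensive.

Import Order.TTheory GRing.Theory Num.Theory.
Import numFieldNormedType.Exports.

Local Open Scope ring_scope.

(* [y] witnesses [x <= u *+ n] for the algebraic preordering of [M]. *)
Definition is_order_unit (M : nmodType) (u : M) :=
  forall x : M, exists (n : nat) (y : M), x + y = u *+ n.

Record oumonoid := OUMonoid {
  ou_sort :> nmodType;
  ou_unit : ou_sort;
  ou_unitP : is_order_unit ou_unit }.

Record ou_hom (M N : oumonoid) := OUHom {
  ou_fun :> M -> N;
  ou_homD : nmod_morphism ou_fun;
  ou_hom_unit : ou_fun (ou_unit M) = ou_unit N }.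

(* A commutative diagram indexed by a poset [P] is a functor from [P]. *)
Record ou_diagram (d : Order.disp_t) (P : porderType d) := OUDiagram {
  oud_ob :> P -> oumonoid;
  oud_map : forall p q : P, (p <= q)%O -> ou_hom (oud_ob p) (oud_ob q);
  oud_id : forall (p : P) (pp : (p <= p)%O) x, oud_map pp x = x;
  oud_comp : forall (p q r : P) (pq : (p <= q)%O) (qr : (q <= r)%O)
    (pr : (p <= r)%O) x, oud_map pr x = oud_map qr (oud_map pq x) }.

(* The inverse of a bijective morphism is automatically a morphism. *)
Definition ou_diagram_iso (d : Order.disp_t) (P : porderType d)
    (D E : ou_diagram P) :=
  exists phi : forall p : P, ou_hom (D p) (E p),
    (forall p, bijective (phi p)) /\
    (forall (p q : P) (pq : (p <= q)%O) x,
       phi q (oud_map D pq x) = oud_map E pq (phi p x)).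

Section Minf.
Variable R : pzRingType.

Definition bounded (n : nat) (f : nat -> nat -> R) :=
  forall i j, (n <= i)%N || (n <= j)%N -> f i j = 0.

(* The union of the M_n(R) along the embeddings adding a zero row and column is
   the set of finitely supported matrices indexed by [nat * nat];
   [Minf_of_mx] is the embedding of M_n(R) into the union. *)
Record Minf := MkMinf {
  Minf_fun :> nat -> nat -> R;
  Minf_fin : exists n, bounded n Minf_fun }.

Lemma MinfP (a b : Minf) : (forall i j, a i j = b i j) -> a = b.
Proof.
case: a b => [f fP] [g gP] /= fg.
have {}fg : f = g by apply/funext => i; apply/funext => j.
by subst g; congr MkMinf; exact: Prop_irrelevance.
Qed.

Lemma bounded_le m n f : (m <= n)%N -> bounded m f -> bounded n f.
Proof.
move=> mn fm i j /orP[] h; apply: fm; rewrite (leq_trans mn h) ?orbT//.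
Qed.

Lemma bounded2 (a b : Minf) : exists n, bounded n a /\ bounded n b.
Proof.
have [m am] := Minf_fin a; have [n bn] := Minf_fin b.
exists (maxn m n); split.
- by apply: bounded_le am; exact: leq_maxl.
- by apply: bounded_le bn; exact: leq_maxr.
Qed.

Lemma Minf0_fin : exists n, bounded n (fun _ _ => 0).
Proof. by exists 0%N. Qed.
Definition Minf0 := MkMinf Minf0_fin.

Lemma Minf_add_fin (a b : Minf) : exists n, bounded n (fun i j => a i j + b i j).
Proof.
have [n [an bn]] := bounded2 a b.
by exists n => i j h; rewrite an// bn// addr0.
Qed.
Definition Minf_add (a b : Minf) := MkMinf (Minf_add_fin a b).

Lemma Minf_addE (a b : Minf) i j : Minf_add a b i j = a i j + b i j.
Proof. by []. Qed.

Lemma Minf_mul_fin (a b : Minf) :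
  exists n, bounded n (fun i j => \sum_(k \in [set: nat]) a i k * b k j).
Proof.
have [n [an bn]] := bounded2 a b.
exists n => i j /orP[] h; apply: fsbig1 => k _.
- by rewrite an ?h// mul0r.
- by rewrite bn ?h ?orbT// mulr0.
Qed.
Definition Minf_mul (a b : Minf) := MkMinf (Minf_mul_fin a b).

Definition mx_entry n (A : 'M[R]_n) (i j : nat) : R :=
  if insub i is Some i' then if insub j is Some j' then A i' j' else 0 else 0.

Lemma mx_entry_fin n (A : 'M[R]_n) : exists m, bounded m (mx_entry A).
Proof.
exists n => i j; rewrite /mx_entry => /orP[]; rewrite leqNgt => h.
- by rewrite insubN.
- by case: insub => // i'; rewrite insubN.
Qed.
Definition Minf_of_mx n (A : 'M[R]_n) := MkMinf (mx_entry_fin A).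

Lemma Minf_of_mxE n (A : 'M[R]_n) (i j : 'I_n) : Minf_of_mx A i j = A i j.
Proof. by rewrite /= /mx_entry !valK. Qed.

Lemma Minf_mulEl n (a b : Minf) i j : (forall k, (n <= k)%N -> a i k = 0) ->
  Minf_mul a b i j = \sum_(k < n) a i k * b k j.
Proof.
move=> an /=.
rewrite (fsbig_ord _ n (fun k => a i k * b k j)); symmetry.
apply: fsbig_widen => // k [_ /= /negP]; rewrite -leqNgt => nk.
by rewrite an// mul0r.
Qed.

Lemma Minf_mulE n (a b : Minf) i j : bounded n a ->
  Minf_mul a b i j = \sum_(k < n) a i k * b k j.
Proof. by move=> an; apply: Minf_mulEl => k nk; apply: an; rewrite nk orbT. Qed.

Lemma Minf_mulA : associative Minf_mul.
Proof.
move=> a b c; apply: MinfP => i j.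
have [n [an bn]] := bounded2 a b.
have abn : bounded n (Minf_mul a b).
  move=> k l h; rewrite (Minf_mulE _ _ _ an) big1// => m _.
  move: h => /orP[] h; first by rewrite an ?h// mul0r.
  by rewrite bn ?h ?orbT// mulr0.
rewrite (Minf_mulE _ _ _ an) (Minf_mulE _ _ _ abn).
under eq_bigr => k _ do rewrite (Minf_mulE _ _ _ bn) big_distrr /=.
under [RHS]eq_bigr => k _ do rewrite (Minf_mulE _ _ _ an) big_distrl /=.
rewrite exchange_big /=; apply: eq_bigr => k _; apply: eq_bigr => l _.
by rewrite mulrA.
Qed.

Lemma Minf_mulDl a b c :
  Minf_mul (Minf_add a b) c = Minf_add (Minf_mul a c) (Minf_mul b c).
Proof.
apply: MinfP => i j; have [n [an bn]] := bounded2 a b.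
have abn : bounded n (Minf_add a b) by move=> k l h; rewrite /= an// bn// addr0.
rewrite Minf_addE (Minf_mulE _ _ _ abn) (Minf_mulE _ _ _ an) (Minf_mulE _ _ _ bn) -big_split.
by apply: eq_bigr => k _; rewrite mulrDl.
Qed.

Lemma Minf_mulDr a b c :
  Minf_mul a (Minf_add b c) = Minf_add (Minf_mul a b) (Minf_mul a c).
Proof.
apply: MinfP => i j; have [n an] := Minf_fin a.
rewrite Minf_addE !(Minf_mulE _ _ _ an) -big_split.
by apply: eq_bigr => k _; rewrite mulrDr.
Qed.

Lemma Minf_addC : commutative Minf_add.
Proof. by move=> a b; apply: MinfP => i j /=; rewrite addrC. Qed.

Lemma Minf_add0 : left_id Minf0 Minf_add.
Proof. by move=> a; apply: MinfP => i j /=; rewrite add0r. Qed.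

Lemma Minf_of_mxM n (A B : 'M[R]_n) :
  Minf_of_mx (A *m B) = Minf_mul (Minf_of_mx A) (Minf_of_mx B).
Proof.
have bd (C : 'M[R]_n) : bounded n (Minf_of_mx C).
  move=> i j; rewrite /= /mx_entry => /orP[]; rewrite leqNgt => h.
  - by rewrite insubN.
  - by case: insub => // i'; rewrite insubN.
apply: MinfP => i j.
have [ni|ni] := leqP n i.
  by rewrite (bd (A *m B)) ?ni// (Minf_mulE _ _ _ (bd A)) big1// => k _;
    rewrite (bd A) ?ni// mul0r.
have [nj|nj] := leqP n j.
  by rewrite (bd (A *m B)) ?nj ?orbT// (Minf_mulE _ _ _ (bd A)) big1// => k _;
    rewrite (bd B) ?nj ?orbT// mulr0.
rewrite (Minf_of_mxE _ (Ordinal ni) (Ordinal nj)) mxE (Minf_mulE _ _ _ (bd A)).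
apply: eq_bigr => k _.
by rewrite (Minf_of_mxE A (Ordinal ni) k) (Minf_of_mxE B k (Ordinal nj)).
Qed.

Lemma Minf_of_mxD n (A B : 'M[R]_n) :
  Minf_of_mx (A + B) = Minf_add (Minf_of_mx A) (Minf_of_mx B).
Proof.
apply: MinfP => i j; rewrite /= /mx_entry.
by case: insub => [i'|]; rewrite ?addr0//; case: insub => [j'|]; rewrite ?addr0// mxE.
Qed.

Lemma Minf_of_mxK n (a : Minf) : bounded n a ->
  a = Minf_of_mx (\matrix_(i < n, j < n) a i j).
Proof.
move=> an; apply: MinfP => i j; rewrite /= /mx_entry.
case: insubP => [i' _ <-|]; last by rewrite -leqNgt => h; rewrite an ?h.
case: insubP => [j' _ <-|]; last by rewrite -leqNgt => h; rewrite an ?h ?orbT.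
by rewrite mxE.
Qed.

Record idem := MkIdem { idem_val :> Minf; idemP : Minf_mul idem_val idem_val = idem_val }.

HB.instance Definition _ := gen_eqMixin idem.
HB.instance Definition _ := gen_choiceMixin idem.

Lemma idem_inj : injective idem_val.
Proof.
by move=> [a aP] [b bP] /= ab; subst b; congr MkIdem; exact: Prop_irrelevance.
Qed.

Definition idem_equiv (a b : Minf) :=
  exists x y : Minf, a = Minf_mul x y /\ b = Minf_mul y x.

Lemma idem_equiv_refl (a : idem) : idem_equiv a a.
Proof. by exists a, a; rewrite idemP. Qed.

Lemma idem_equiv_sym (a b : Minf) : idem_equiv a b -> idem_equiv b a.
Proof. by move=> [x [y [-> ->]]]; exists y, x. Qed.

Lemma idem_equiv_trans (b a c : idem) :
  idem_equiv a b -> idem_equiv b c -> idem_equiv a c.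
Proof.
move=> [x [y [axy byx]]] [z [t [bzt ctz]]].
exists (Minf_mul x z), (Minf_mul t y); split.
- rewrite -Minf_mulA [Minf_mul z _]Minf_mulA -bzt byx -!Minf_mulA.
  by rewrite [Minf_mul x (Minf_mul y _)]Minf_mulA -axy idemP.
- rewrite -Minf_mulA [Minf_mul y _]Minf_mulA -byx bzt -!Minf_mulA.
  by rewrite [Minf_mul t (Minf_mul z _)]Minf_mulA -ctz idemP.
Qed.

Definition idem_eqv (a b : idem) : bool := `[< idem_equiv a b >].

Lemma idem_eqv_equiv : equiv_class_of idem_eqv.
Proof.
split=> [a|a b|b a c].
- by apply/asboolP; exact: idem_equiv_refl.
- by apply/asboolP/asboolP; exact: idem_equiv_sym.
- by move=> /asboolP ab /asboolP bc; apply/asboolP; exact: idem_equiv_trans ab bc.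
Qed.

Canonical idem_equiv_rel := EquivRelPack idem_eqv_equiv.

Definition V := {eq_quot idem_equiv_rel}%qT.
HB.instance Definition _ := Choice.on V.

Definition V_class (a : idem) : V := (\pi_V a)%qT.

Lemma V_classP (a b : idem) : V_class a = V_class b <-> idem_equiv a b.
Proof.
split=> [ab|ab].
- apply/asboolP; change (idem_equiv_rel a b); rewrite -eqmodE.
  by apply/eqP.
- by apply/eqP; rewrite /V_class eqmodE; apply/asboolP.
Qed.

Lemma V_classK (u : V) : V_class (repr u) = u.
Proof. exact: reprK. Qed.

(* A copy of [a] on the even indices and of [b] on the odd indices: these
   copies are orthogonal idempotents, equivalent to [a] and [b]. *)
Lemma dsum_fin (a b : Minf) : exists n, bounded n (fun i j =>
  if odd i == odd j then (if odd i then b else a) i./2 j./2 else 0).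
Proof.
have [n [an bn]] := bounded2 a b.
exists n.*2 => i j h; case: eqP => // _.
have {}h : (n <= i./2)%N || (n <= j./2)%N.
  by case/orP: h => /half_leq; rewrite doubleK => ->; rewrite ?orbT.
by case: (odd i); [apply: bn|apply: an].
Qed.
Definition dsum (a b : Minf) := MkMinf (dsum_fin a b).

Lemma dsum_ee a b i j : dsum a b i.*2 j.*2 = a i j.
Proof. by rewrite /= !odd_double !doubleK. Qed.
Lemma dsum_oo a b i j : dsum a b i.*2.+1 j.*2.+1 = b i j.
Proof. by rewrite /= !odd_double /= !uphalf_double. Qed.
Lemma dsum_eo a b i j : dsum a b i.*2 j.*2.+1 = 0.
Proof. by rewrite /= !odd_double. Qed.
Lemma dsum_oe a b i j : dsum a b i.*2.+1 j.*2 = 0.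
Proof. by rewrite /= !odd_double. Qed.
Definition dsumE := (dsum_ee, dsum_oo, dsum_eo, dsum_oe).

Lemma bounded_dsum n (a b : Minf) : bounded n a -> bounded n b -> bounded n.*2 (dsum a b).
Proof.
move=> an bn i j h /=; case: eqP => // _.
have {}h : (n <= i./2)%N || (n <= j./2)%N.
  by case/orP: h => /half_leq; rewrite doubleK => ->; rewrite ?orbT.
by case: (odd i); [apply: bn|apply: an].
Qed.

Lemma sum_double n (F : nat -> R) :
  \sum_(k < n.*2) F k = \sum_(k < n) F k.*2 + \sum_(k < n) F k.*2.+1.
Proof.
elim: n => [|n IH]; first by rewrite !big_ord0 addr0.
rewrite doubleS !big_ord_recr /= IH -!addrA; congr (_ + _).
by rewrite addrCA.
Qed.

Lemma parity_ind (P : nat -> Prop) :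
  (forall i, P i.*2) -> (forall i, P i.*2.+1) -> forall i, P i.
Proof.
move=> Pe Po i; rewrite -(odd_double_half i).
by case: (odd i); [apply: Po|apply: Pe].
Qed.

Lemma dsumM a b c d :
  Minf_mul (dsum a b) (dsum c d) = dsum (Minf_mul a c) (Minf_mul b d).
Proof.
have [n [an bn]] := bounded2 a b.
have En i j := etrans (Minf_mulE (dsum c d) i j (bounded_dsum an bn))
  (sum_double n (fun k => dsum a b i k * dsum c d k j)).
have Ea i j := Minf_mulE c i j an.
have Eb i j := Minf_mulE d i j bn.
apply: MinfP.
apply: parity_ind => i; apply: parity_ind => j; rewrite En.
- rewrite dsum_ee Ea [X in _ + X]big1 ?addr0; last by move=> k _; rewrite dsumE mul0r.
  by apply: eq_bigr => k _; rewrite !dsumE.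
- by rewrite dsum_eo !big1 ?addr0// => k _; rewrite !dsumE ?mulr0 ?mul0r.
- by rewrite dsum_oe !big1 ?addr0// => k _; rewrite !dsumE ?mulr0 ?mul0r.
- rewrite dsum_oo Eb [X in X + _]big1 ?add0r; last by move=> k _; rewrite dsumE mul0r.
  by apply: eq_bigr => k _; rewrite !dsumE.
Qed.

Lemma idem_dsumP (a b : idem) : Minf_mul (dsum a b) (dsum a b) = dsum a b.
Proof. by rewrite dsumM !idemP. Qed.
Definition idem_dsum (a b : idem) := MkIdem (idem_dsumP a b).

(* Classes are added on orthogonal representatives; by [V_addE_orth] below, any
   orthogonal representatives give the same sum. *)
Definition V_add (u v : V) : V := V_class (idem_dsum (repr u) (repr v)).

Lemma V_add_class (a b : idem) :
  V_add (V_class a) (V_class b) = V_class (idem_dsum a b).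
Proof.
apply/V_classP.
have /V_classP[x [y [ax ay]]] := V_classK (V_class a).
have /V_classP[z [t [bz bt]]] := V_classK (V_class b).
exists (dsum x z), (dsum y t); rewrite !dsumM.
change (dsum (repr (V_class a)) (repr (V_class b)) = dsum (Minf_mul x y) (Minf_mul z t) /\
  dsum a b = dsum (Minf_mul y x) (Minf_mul t z)).
by rewrite ax ay bz bt.
Qed.

Lemma zip_fin (a b : Minf) : exists n, bounded n (fun i j =>
  (if odd j then b else a) i j./2).
Proof.
have [n [an bn]] := bounded2 a b.
exists n.*2 => i j h.
have {}h : (n <= i)%N || (n <= j./2)%N.
  case/orP: h => h; last by move/half_leq: h; rewrite doubleK => ->; rewrite orbT.
  by rewrite (leq_trans _ h)// -addnn leq_addr.
by case: (odd j); [apply: bn|apply: an].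
Qed.

Lemma tzip_fin (a b : Minf) : exists n, bounded n (fun i j =>
  (if odd i then b else a) i./2 j).
Proof.
have [n [an bn]] := bounded2 a b.
exists n.*2 => i j h.
have {}h : (n <= i./2)%N || (n <= j)%N.
  case/orP: h => h; first by move/half_leq: h; rewrite doubleK => ->.
  by rewrite (leq_trans _ h) ?orbT// -addnn leq_addr.
by case: (odd i); [apply: bn|apply: an].
Qed.

Lemma add_dsum_equiv (a b : idem) :
  Minf_mul a b = Minf0 -> Minf_mul b a = Minf0 ->
  idem_equiv (Minf_add a b) (dsum a b).
Proof.
move=> ab ba.
have [n [an bn]] := bounded2 a b.
pose x := MkMinf (zip_fin a b); pose y := MkMinf (tzip_fin a b).
have xe i k : x i k.*2 = a i k by rewrite /= odd_double doubleK.
have xo i k : x i k.*2.+1 = b i k by rewrite /= odd_double /= uphalf_double.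
have ye i k : y i.*2 k = a i k by rewrite /= odd_double doubleK.
have yo i k : y i.*2.+1 k = b i k by rewrite /= odd_double /= uphalf_double.
have xn i k : (n.*2 <= k)%N -> x i k = 0.
  move=> nk /=; have {}nk : (n <= k./2)%N by move/half_leq: nk; rewrite doubleK.
  by case: (odd k); rewrite ?an ?bn ?nk ?orbT.
have yn i k : (n <= k)%N -> y i k = 0.
  by move=> nk /=; case: (odd i); rewrite ?an ?bn ?nk ?orbT.
have aE (c : Minf) i j := Minf_mulE c i j an.
have bE (c : Minf) i j := Minf_mulE c i j bn.
exists x, y; split; apply: MinfP.
- move=> i j; rewrite (Minf_mulEl y j (xn i)) (sum_double n (fun k => x i k * y k j)).
  rewrite -{1}(idemP a) -{1}(idemP b).
  change (Minf_mul a a i j + Minf_mul b b i j = \sum_(k < n) x i k.*2 * y k.*2 j +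
    \sum_(k < n) x i k.*2.+1 * y k.*2.+1 j).
  by rewrite aE bE; congr (_ + _); apply: eq_bigr => k _; rewrite ?xe ?ye ?xo ?yo.
- apply: parity_ind => i; apply: parity_ind => j; rewrite (Minf_mulEl x _ (yn _)).
  + rewrite dsumE -{1}(idemP a) aE.
    by apply: eq_bigr => k _; rewrite ye xe.
  + transitivity (Minf_mul a b i j); first by rewrite ab dsumE.
    by rewrite aE; apply: eq_bigr => k _; rewrite ye xo.
  + transitivity (Minf_mul b a i j); first by rewrite ba dsumE.
    by rewrite bE; apply: eq_bigr => k _; rewrite yo xe.
  + rewrite dsumE -{1}(idemP b) bE.
    by apply: eq_bigr => k _; rewrite yo xo.
Qed.

Lemma V_add_orth (a b c : idem) :
  Minf_mul a b = Minf0 -> Minf_mul b a = Minf0 -> c = Minf_add a b :> Minf ->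
  V_add (V_class a) (V_class b) = V_class c.
Proof.
move=> ab ba cab; rewrite V_add_class; apply/V_classP.
by rewrite cab; apply: idem_equiv_sym; exact: add_dsum_equiv.
Qed.

Lemma Minf_mul0l a : Minf_mul Minf0 a = Minf0.
Proof. by apply: MinfP => i j /=; rewrite fsbig1// => k _; rewrite mul0r. Qed.
Lemma Minf_mul0r a : Minf_mul a Minf0 = Minf0.
Proof. by apply: MinfP => i j /=; rewrite fsbig1// => k _; rewrite mulr0. Qed.

Definition idem0 := MkIdem (Minf_mul0l Minf0).

Definition V_zero : V := V_class idem0.

Lemma dsum0 : dsum Minf0 Minf0 = Minf0.
Proof. by apply: MinfP => i j /=; case: eqP => // _; case: odd. Qed.

Lemma V_add0 : left_id V_zero V_add.
Proof.
move=> u; rewrite -[u]V_classK; apply: V_add_orth.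
- exact: Minf_mul0l.
- exact: Minf_mul0r.
- by rewrite Minf_add0.
Qed.

Lemma dsum0r_mul0l a b c d :
  Minf_mul (dsum a Minf0) (dsum Minf0 b) = Minf0 /\
  Minf_mul (dsum Minf0 c) (dsum d Minf0) = Minf0.
Proof. by rewrite !dsumM !Minf_mul0l !Minf_mul0r dsum0. Qed.

Lemma dsumD a b c d :
  Minf_add (dsum a b) (dsum c d) = dsum (Minf_add a c) (Minf_add b d).
Proof.
apply: MinfP => i j /=; case: eqP => _; last by rewrite addr0.
by case: odd.
Qed.

Lemma V_class_dsum0 (a : idem) : V_class (idem_dsum a idem0) = V_class a.
Proof.
apply/V_classP; apply: idem_equiv_sym.
have <- : Minf_add a Minf0 = a by rewrite Minf_addC Minf_add0.
by apply: (@add_dsum_equiv a idem0); [exact: Minf_mul0r|exact: Minf_mul0l].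
Qed.

Lemma V_class_0dsum (a : idem) : V_class (idem_dsum idem0 a) = V_class a.
Proof.
apply/V_classP; apply: idem_equiv_sym.
have <- : Minf_add Minf0 a = a by rewrite Minf_add0.
by apply: (@add_dsum_equiv idem0 a); [exact: Minf_mul0l|exact: Minf_mul0r].
Qed.

Lemma V_addC : commutative V_add.
Proof.
move=> u v; rewrite -[u]V_classK -[v]V_classK.
move: (repr u) (repr v) => a b; rewrite V_add_class.
rewrite -(V_class_0dsum b) -(V_class_dsum0 a); symmetry; apply: V_add_orth.
- exact: (dsum0r_mul0l Minf0 Minf0 _ _).2.
- exact: (dsum0r_mul0l _ _ Minf0 Minf0).1.
- by rewrite dsumD Minf_add0 Minf_addC Minf_add0.
Qed.

Lemma V_addA : associative V_add.
Proof.
move=> u v w; rewrite -[u]V_classK -[v]V_classK -[w]V_classK.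
move: (repr u) (repr v) (repr w) => a b c.
pose a' := idem_dsum (idem_dsum a idem0) idem0.
pose b' := idem_dsum (idem_dsum idem0 b) idem0.
pose c' := idem_dsum idem0 c.
have -> : V_class a = V_class a' by rewrite !V_class_dsum0.
have -> : V_class b = V_class b' by rewrite V_class_dsum0 V_class_0dsum.
have -> : V_class c = V_class c' by rewrite V_class_0dsum.
have D0 : dsum Minf0 Minf0 = Minf0 := dsum0.
have add0 x : Minf_add Minf0 x = x by rewrite Minf_add0.
have addr0 x : Minf_add x Minf0 = x by rewrite Minf_addC Minf_add0.
rewrite (@V_add_orth b' c' (idem_dsum (idem_dsum idem0 b) c)); first last.
- by rewrite dsumD add0 addr0.
- by rewrite !dsumM !Minf_mul0l !Minf_mul0r D0.
- by rewrite !dsumM !Minf_mul0l !Minf_mul0r D0.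
rewrite (@V_add_orth a' b' (idem_dsum (idem_dsum a b) idem0)); first last.
- by rewrite !dsumD !add0 !addr0.
- by rewrite !dsumM !Minf_mul0l !Minf_mul0r !D0.
- by rewrite !dsumM !Minf_mul0l !Minf_mul0r !D0.
rewrite (@V_add_orth _ _ (idem_dsum (idem_dsum a b) c)); first last.
- by rewrite !dsumD !add0 !addr0.
- by rewrite !dsumM !Minf_mul0l !Minf_mul0r !D0.
- by rewrite !dsumM !Minf_mul0l !Minf_mul0r !D0.
rewrite (@V_add_orth _ _ (idem_dsum (idem_dsum a b) c)) //.
- by rewrite !dsumM !Minf_mul0l !Minf_mul0r !D0.
- by rewrite !dsumM !Minf_mul0l !Minf_mul0r !D0.
- by rewrite !dsumD !add0 !addr0.
Qed.

HB.instance Definition _ := GRing.isNmodule.Build V V_addA V_addC V_add0.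

Lemma V_addE (a b : idem) : V_class a + V_class b = V_class (idem_dsum a b).
Proof. exact: V_add_class. Qed.

Lemma V_addE_orth (a b c : idem) :
  Minf_mul a b = Minf0 -> Minf_mul b a = Minf0 -> c = Minf_add a b :> Minf ->
  V_class a + V_class b = V_class c.
Proof. exact: V_add_orth. Qed.

Lemma Minf_of_mx_idem n (A : 'M[R]_n) : A *m A = A ->
  Minf_mul (Minf_of_mx A) (Minf_of_mx A) = Minf_of_mx A.
Proof. by move=> AA; rewrite -Minf_of_mxM AA. Qed.

Definition idem_of_mx n (A : 'M[R]_n) (AA : A *m A = A) :=
  MkIdem (Minf_of_mx_idem AA).

(* The unit of [R], viewed as a 1 x 1 matrix. *)
Definition V_unit : V := V_class (idem_of_mx (mulmx1 (1%:M : 'M[R]_1))).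

Lemma mx_entry_delta m i j :
  mx_entry (delta_mx ord0 ord0 : 'M[R]_m.+1) i j = ((i == 0%N) && (j == 0%N))%:R.
Proof.
rewrite /mx_entry; case: insubP => [i' _ <-|]; last by case: i.
case: insubP => [j' _ <-|]; last by case: j => // j; rewrite andbF.
by rewrite mxE -!val_eqE.
Qed.

Lemma V_class_idmx n :
  V_class (idem_of_mx (mulmx1 (1%:M : 'M[R]_n))) = V_unit *+ n.
Proof.
elim: n => [|n IH].
  rewrite mulr0n; congr V_class; apply: idem_inj; apply: MinfP => i j /=.
  by rewrite /mx_entry insubN.
pose P : 'M[R]_n.+1 := \matrix_(i, j) ((i == j) && (i < n)%N)%:R.
pose Q : 'M[R]_n.+1 := delta_mx ord_max ord_max.
have PQ : P + Q = 1%:M.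
  apply/matrixP => i j; rewrite !mxE; case: (eqVneq i j) => [<-|ij] /=.
    have [im|im] := eqVneq i ord_max; first by rewrite im /= ltnn add0r.
    have -> : (i < n)%N by have := ltn_ord i; rewrite ltnS leq_eqVlt => /orP[/eqP e|//];
      case/eqP: im; apply: val_inj.
    by rewrite addr0.
  rewrite add0r; case: eqP => //= im; case: eqP => //= jm.
  by rewrite im jm eqxx in ij.
have QQ : Q *m Q = Q by rewrite mul_delta_mx.
have QP : Q *m P = 0.
  apply/matrixP => i j; rewrite !mxE big1// => k _; rewrite !mxE.
  have [->|] := eqVneq k ord_max; last by rewrite andbF mul0r.
  by rewrite /= ltnn andbF mulr0.
have PQ0 : P *m Q = 0.
  apply/matrixP => i j; rewrite !mxE big1// => k _; rewrite !mxE.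
  have [->|] := eqVneq k ord_max; last by rewrite mulr0.
  have [->|] := eqVneq i ord_max; last by rewrite mul0r.
  by rewrite /= ltnn mul0r.
have PP : P *m P = P.
  by rewrite -[RHS]mulmx1 -PQ mulmxDr PQ0 addr0.
have mx0 : Minf_of_mx (0 : 'M[R]_n.+1) = Minf0.
  by apply: MinfP => i j; rewrite /= /mx_entry; case: insub => // ?; case: insub => // ?; rewrite mxE.
rewrite mulrSr -IH.
have -> : V_class (idem_of_mx (mulmx1 (1%:M : 'M[R]_n))) = V_class (idem_of_mx PP).
  congr V_class; apply: idem_inj; apply: MinfP => i j /=; rewrite /mx_entry.
  case: (insubP 'I_n i) => [i' ii' vi|]; last first.
    rewrite -leqNgt => ni; case: insubP => // i' _ vi; case: insubP => // j' _ _.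
    by rewrite !mxE vi ltnNge ni andbF.
  rewrite (insubT (fun x => x < n.+1)%N) => [|hi]; first by rewrite ltnS ltnW.
  case: (insubP 'I_n j) => [j' jj' vj|]; last first.
    rewrite -leqNgt => nj; case: insubP => // j' _ vj.
    rewrite !mxE /= ii' andbT -val_eqE /= vj.
    by case: eqP => // ij; move: ii'; rewrite ij ltnNge nj.
  rewrite (insubT (fun x => x < n.+1)%N) => [|hj]; first by rewrite ltnS ltnW.
  by rewrite !mxE /= ii' andbT -!val_eqE /= vi vj.
have -> : V_unit = V_class (idem_of_mx QQ).
  apply/V_classP.
  pose E0 : 'M[R]_n.+1 := delta_mx ord0 ord_max.
  pose E1 : 'M[R]_n.+1 := delta_mx ord_max ord0.
  exists (Minf_of_mx E0), (Minf_of_mx E1); rewrite -!Minf_of_mxM !mul_delta_mx; split=> //.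
  change (Minf_of_mx (1%:M : 'M[R]_1) = Minf_of_mx (delta_mx ord0 ord0 : 'M[R]_n.+1)).
  have -> : (1%:M : 'M[R]_1) = delta_mx ord0 ord0.
    by apply/matrixP => i j; rewrite !mxE !ord1.
  by apply: MinfP => i j; rewrite /= !mx_entry_delta.
symmetry; apply: V_addE_orth; rewrite /= -?Minf_of_mxM ?PQ0 ?QP//.
by rewrite -Minf_of_mxD PQ.
Qed.

Lemma V_unitP : is_order_unit V_unit.
Proof.
move=> u; rewrite -[u]V_classK; move: (repr u) => a.
have [n an] := Minf_fin a; exists n.
have := Minf_of_mxK an; set A := \matrix_(i, j) _ => aA.
have AA : A *m A = A.
  apply/matrixP => i j; have := idemP a; rewrite aA -Minf_of_mxM => E.
  by rewrite -Minf_of_mxE E Minf_of_mxE.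
have BB : (1%:M - A) *m (1%:M - A) = 1%:M - A.
  by rewrite mulmxBr mulmx1 mulmxBl mul1mx AA subrr subr0.
exists (V_class (idem_of_mx BB)); rewrite -V_class_idmx.
have mx0 : Minf_of_mx (0 : 'M[R]_n) = Minf0.
  by apply: MinfP => i j; rewrite /= /mx_entry; case: insub => // ?; case: insub => // ?; rewrite mxE.
apply: V_addE_orth; rewrite aA /=.
- by rewrite -Minf_of_mxM mulmxBr mulmx1 AA subrr mx0.
- by rewrite -Minf_of_mxM mulmxBl mul1mx AA subrr mx0.
- by rewrite -Minf_of_mxD addrC subrK.
Qed.

Definition V1 : oumonoid := OUMonoid V_unitP.

End Minf.

Section Vmap.
Variables (R S : pzRingType) (f : {rmorphism R -> S}).

Lemma Minf_map_fin (a : Minf R) : exists n, bounded n (fun i j => f (a i j)).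
Proof. by have [n an] := Minf_fin a; exists n => i j h; rewrite an// rmorph0. Qed.
Definition Minf_map (a : Minf R) := MkMinf (Minf_map_fin a).

Lemma Minf_mapM a b : Minf_map (Minf_mul a b) = Minf_mul (Minf_map a) (Minf_map b).
Proof.
apply: MinfP => i j; have [n an] := Minf_fin a.
have fan : bounded n (Minf_map a) by move=> k l h /=; rewrite an// rmorph0.
change (f (Minf_mul a b i j) = Minf_mul (Minf_map a) (Minf_map b) i j).
rewrite (Minf_mulE _ _ _ fan) (Minf_mulE _ _ _ an).
by rewrite rmorph_sum; apply: eq_bigr => k _; rewrite rmorphM.
Qed.

Lemma idem_mapP (a : idem R) :
  Minf_mul (Minf_map a) (Minf_map a) = Minf_map a.
Proof. by rewrite -Minf_mapM idemP. Qed.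
Definition idem_map (a : idem R) := MkIdem (idem_mapP a).

Definition V_map (u : V R) : V S := V_class (idem_map (repr u)).

Lemma V_map_class (a : idem R) : V_map (V_class a) = V_class (idem_map a).
Proof.
apply/V_classP.
have /V_classP[x [y [ax ay]]] := V_classK (V_class a).
exists (Minf_map x), (Minf_map y); rewrite -!Minf_mapM.
change (Minf_map (repr (V_class a)) = Minf_map (Minf_mul x y) /\
  Minf_map a = Minf_map (Minf_mul y x)).
by rewrite ax ay.
Qed.

Lemma V_map_morph : nmod_morphism V_map.
Proof.
split.
  rewrite [LHS]V_map_class; congr V_class; apply: idem_inj.
  by apply: MinfP => i j /=; rewrite rmorph0.
move=> u v; rewrite -[u]V_classK -[v]V_classK V_addE !V_map_class V_addE.
congr V_class; apply: idem_inj; apply: MinfP => i j /=.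
by case: eqP => _; rewrite ?rmorph0//; case: odd.
Qed.

Lemma V_map_unit : V_map (V_unit R) = V_unit S.
Proof.
rewrite V_map_class; congr V_class; apply: idem_inj; apply: MinfP => i j /=.
rewrite /mx_entry; case: insub => [i'|]; rewrite ?rmorph0//.
by case: insub => [j'|]; rewrite ?rmorph0// !mxE rmorph_nat.
Qed.

Definition V1_map : ou_hom (V1 R) (V1 S) :=
  @OUHom (V1 R) (V1 S) V_map V_map_morph V_map_unit.

End Vmap.

(* The multiplication is part of the mixin because the MathComp hierarchy does
   not allow a join of its ring structures with its normed modules over an
   arbitrary field; the ring structure is recovered in [cring] below.  Norms of
   a [normedModType] over [R[i]] take their values in [R[i]]. *)
HB.mixin Record isCStarAlgebra (R : realType) A & CompleteNormedModule R[i] A := {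
  cmul : A -> A -> A;
  cone : A;
  star : A -> A;
  cmulA : associative cmul;
  cmul1l : left_id cone cmul;
  cmul1r : right_id cone cmul;
  cmulDl : left_distributive cmul +%R;
  cmulDr : right_distributive cmul +%R;
  cmulZl : forall (c : R[i]) (x y : A), cmul (c *: x) y = c *: cmul x y;
  cmulZr : forall (c : R[i]) (x y : A), cmul x (c *: y) = c *: cmul x y;
  starK : involutive star;
  starD : {morph star : x y / x + y};
  starZ : forall (c : R[i]) (x : A), star (c *: x) = c^* *: star x;
  starM : forall x y : A, star (cmul x y) = cmul (star y) (star x);
  cnormM_le : forall x y : A, `|cmul x y| <= `|x| * `|y|;
  cnorm_star : forall x : A, `|cmul (star x) x| = `|x| ^+ 2
}.

#[short(type="cstarType")]
HB.structure Definition CStarAlgebra (R : realType) :=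
  {A of CompleteNormedModule R[i] A & isCStarAlgebra R A}.

Definition cring (R : realType) (A : cstarType R) : Type := A.

Section CRing.
Variables (R : realType) (A : cstarType R).
HB.instance Definition _ := GRing.Zmodule.copy (cring A) A.
HB.instance Definition _ := GRing.Zmodule_isPzRing.Build (cring A)
  (@cmulA R A) (@cmul1l R A) (@cmul1r R A) (@cmulDl R A) (@cmulDr R A).
End CRing.

Record cstar_hom (R : realType) (A B : cstarType R) := CStarHom {
  ch_fun :> A -> B;
  ch_linear : linear ch_fun;
  ch_mul : {morph ch_fun : x y / cmul x y};
  ch_one : ch_fun cone = cone;
  ch_star : {morph ch_fun : x / star x} }.

Section CRingHom.
Variables (R : realType) (A B : cstarType R) (f : cstar_hom A B).

Definition cring_hom : cring A -> cring B := f.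

Lemma cring_homB : zmod_morphism cring_hom.
Proof.
move=> x y; change (f ((x : A) - y) = f x - f y).
by rewrite addrC -scaleN1r ch_linear scaleN1r addrC.
Qed.

Lemma cring_homM : monoid_morphism cring_hom.
Proof. by split; [exact: ch_one|exact: ch_mul]. Qed.

HB.instance Definition _ :=
  GRing.isZmodMorphism.Build (cring A) (cring B) cring_hom cring_homB.
HB.instance Definition _ :=
  GRing.isMonoidMorphism.Build (cring A) (cring B) cring_hom cring_homM.

End CRingHom.

Record cstar_diagram (R : realType) (d : Order.disp_t) (P : porderType d) :=
    CStarDiagram {
  csd_ob :> P -> cstarType R;
  csd_map : forall p q : P, (p <= q)%O -> cstar_hom (csd_ob p) (csd_ob q);
  csd_id : forall (p : P) (pp : (p <= p)%O) x, csd_map pp x = x;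
  csd_comp : forall (p q r : P) (pq : (p <= q)%O) (qr : (q <= r)%O)
    (pr : (p <= r)%O) x, csd_map pr x = csd_map qr (csd_map pq x) }.

Section V1Diagram.
Variables (R : realType) (d : Order.disp_t) (P : porderType d).
Variable D : cstar_diagram R P.

Definition V1d_ob (p : P) : oumonoid := V1 (cring (D p)).

Definition V1d_map (p q : P) (pq : (p <= q)%O) : ou_hom (V1d_ob p) (V1d_ob q) :=
  V1_map (cring_hom (csd_map D pq)).

Lemma V1d_id p (pp : (p <= p)%O) x : V1d_map pp x = x.
Proof.
change (V_map (cring_hom (csd_map D pp)) x = x).
rewrite -[x]V_classK V_map_class; congr V_class; apply: idem_inj.
by apply: MinfP => i j; exact: csd_id.
Qed.

Lemma V1d_comp (p q r : P) (pq : (p <= q)%O) (qr : (q <= r)%O) (pr : (p <= r)%O) x :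
  V1d_map pr x = V1d_map qr (V1d_map pq x).
Proof.
change (V_map (cring_hom (csd_map D pr)) x =
  V_map (cring_hom (csd_map D qr)) (V_map (cring_hom (csd_map D pq)) x)).
rewrite -[x]V_classK; move: (repr x) => a.
rewrite (V_map_class (cring_hom (csd_map D pq)) a) !V_map_class.
congr V_class; apply: idem_inj.
by apply: MinfP => i j; exact: (csd_comp pq qr pr).
Qed.

Definition V1_diagram : ou_diagram P := OUDiagram V1d_id V1d_comp.

End V1Diagram.

(* {0,1}^3 with the componentwise ordering. *)
Notation cube := (bool *p bool *p bool)%type.

(* The vertices [A_j] are the atoms and the vertices [B_j] the coatoms, with
   [A_j <= B_k] if and only if [j != k]. *)
Notation vA := (false, false, false).
Notation vA0 := (true, false, false).
Notation vA1 := (false, true, false).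
Notation vA2 := (false, false, true).
Notation vB0 := (false, true, true).
Notation vB1 := (true, false, true).
Notation vB2 := (true, true, false).
Notation vB := (true, true, true).

Lemma nat1_order_unit : is_order_unit (1%N : nat).
Proof. by move=> n; exists n, 0%N; rewrite addr0; exact: (esym (natn n)). Qed.

Lemma nat2_order_unit : is_order_unit (2%N : nat).
Proof.
move=> n; exists n, n; elim: n => // n IH; rewrite mulrS -IH.
by change (n.+1 + n.+1 = 2 + (n + n))%N; rewrite addSn addnS.
Qed.

Lemma nat11_order_unit : is_order_unit ((1%N, 1%N) : nat * nat).
Proof.
move=> [m n]; exists (m + n)%N, (n, m).
suff -> : ((1%N, 1%N) : nat * nat) *+ (m + n) = (m + n, m + n)%N.
  by congr pair; rewrite [LHS]addnC.
elim: (m + n)%N => // k IH; rewrite mulrS IH; congr pair.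
Qed.

Definition N1 := OUMonoid nat1_order_unit.
Definition N2 := OUMonoid nat2_order_unit.
Definition NN11 := OUMonoid nat11_order_unit.

Definition Du_ob (p : cube) : oumonoid :=
  match p with
  | vA => N1
  | vB => N2
  | _ => NN11
  end.

Definition emap (x : nat) : nat * nat := (x, x).
Definition smap (x : nat * nat) : nat * nat := (x.2, x.1).
Definition hmap (x : nat * nat) : nat := (x.1 + x.2)%N.

(* The arrow from [p] to [q] when [p <= q]; the values for incomparable [p] and
   [q] are irrelevant.  The arrow from [vA1] to [vB2] is the only arrow between
   middle vertices which is not an identity.  An arrow that does not join
   neighbouring vertices is the common value of the composites of the arrows
   along the edges: [e] from [vA] to [vBj], [h] from [vAj] to [vB]. *)
Definition Du_fun (p q : cube) : Du_ob p -> Du_ob q :=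
  match p, q with
  | vA, vA => id
  | vA, vB => hmap \o emap
  | vA, _ => emap
  | vB, vB => id
  | vB, _ => fun=> 0
  | _, vA => fun=> 0
  | _, vB => hmap
  | vA1, vB2 => smap
  | _, _ => id
  end.

Lemma emap_morph : nmod_morphism emap.
Proof. by []. Qed.

Lemma smap_morph : nmod_morphism smap.
Proof. by []. Qed.

Lemma hmap_morph : nmod_morphism hmap.
Proof. by split=> // x y; exact: addnACA. Qed.

Lemma Du_fun_morph (p q : cube) : nmod_morphism (@Du_fun p q).
Proof.
have he : nmod_morphism (hmap \o emap).
  by split=> // x y; exact: addnACA.
case: p => [[[] []] []]; case: q => [[[] []] []] //;
  by [exact: emap_morph|exact: smap_morph|exact: hmap_morph].
Qed.

Lemma Du_fun_unit (p q : cube) : (p <= q)%O ->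
  Du_fun q (ou_unit (Du_ob p)) = ou_unit (Du_ob q).
Proof. by case: p => [[[] []] []]; case: q => [[[] []] []]. Qed.

Definition Du_map (p q : cube) (pq : (p <= q)%O) : ou_hom (Du_ob p) (Du_ob q) :=
  OUHom (Du_fun_morph p q) (Du_fun_unit pq).

Lemma Du_id (p : cube) (pp : (p <= p)%O) x : Du_map pp x = x.
Proof. by move: pp x; case: p => [[[] []] []]. Qed.

Lemma Du_comp (p q r : cube) (pq : (p <= q)%O) (qr : (q <= r)%O)
  (pr : (p <= r)%O) x : Du_map pr x = Du_map qr (Du_map pq x).
Proof.
change (Du_fun r x = Du_fun r (Du_fun q x)).
have hs y : hmap y = hmap (smap y) by rewrite /hmap addnC.
move: pq qr x {pr}; case: p => [[[] []] []]; case: q => [[[] []] []] // _;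
  case: r => [[[] []] []] // _ x; exact: hs.
Qed.

Definition Du : ou_diagram cube := OUDiagram Du_id Du_comp.

(* Main.v *)
Require Import Defs.
From HB Require Import structures.
From mathcomp Require Import all_boot all_order all_algebra.
From mathcomp Require Import all_classical all_reals topology normedtype.
From mathcomp Require Import derive realfun complex ring lra.

(** All vertices but [B_2] are lifted to finite-dimensional algebras: [A] to [C],
    [B] to [M_2(C)], and the [A_j], [B_0] and [B_1] to the diagonal matrices
    [C^2], with inclusions as arrows.  This does not work for [B_2], as the arrow
    [A_1 -> B_2] has to swap the two diagonal idempotents in [V] while being the
    inclusion after composition with [B_2 -> B].  So [B_2] is the algebra of
    continuous paths in [M_2(C)] starting at a diagonal matrix, it goes to [B]
    by evaluation at [1], the arrow from [A_0] takes constant paths, and the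
    arrow from [A_1] conjugates by a path of rotations joining the quarter turn
    to the identity.

    Idempotent matrices over [B_2] are equivalent to their values at [0]: if [E]
    is such a matrix then [t |-> E(min(s, t))] is, by connectedness of the line,
    of a class independent of [s], because two uniformly close idempotents [E],
    [F] are conjugate by [E F + (1 - E) (1 - F)].  Over a field idempotent
    matrices are classified by their ranks, which are also their traces. *)

Set Implicit Arguments.
Unset Strict Implicit.
Unset Printing Implicit Defensive.

Import Order.TTheory GRing.Theory Num.Theory.
Import numFieldNormedType.Exports Normc.

Local Open Scope ring_scope.
Local Notation cre := (@complex.Re _).
Local Notation cim := (@complex.Im _).

(** * The operator norm *)

(** Every vertex is an algebra of functions from the line to [M_2(C)], the finite-dimensional ones
    consisting of constant functions. One construction thus yields all the C*-algebras, and every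
    arrow is a reparametrisation followed by conjugation by unitaries. The two ends of a path play
    opposite roles. At [0] the values are diagonal, hence commute, so each diagonal entry at [0] is
    a trace; these traces separate the two diagonal idempotents of [B_2], although the two become
    equivalent in [M_2(C)]. If [U] is the path of rotations, [U E_11 U^*] is equivalent to [E_22]
    through [U E_12], which is a legitimate element because it is diagonal at [0], unlike the
    constant path [E_12]: this produces the swap. At [1] the rotation disappears, so the square from
    [A_1] to [B] commutes. Scalars commute with rotations, so the square from [A] to [B_2] commutes
    as well. Both hold strictly, not only up to equivalence. *)

Section HilbertNorm.
Variable R : realType.
Local Notation C := R[i].
Implicit Types (z : C) (u v w : 'cV[C]_2) (x y : 'M[C]_2).

Lemma normr_normc z : `|z| = (normc z)%:C%C.
Proof. by []. Qed.

Lemma normc_ge0 z : 0 <= normc z.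
Proof. by case: z => a b; exact: sqrtr_ge0. Qed.

Lemma normc_conj z : normc z^* = normc z.
Proof. by case: z => a b; rewrite /= sqrrN. Qed.

Lemma normc_sum n (F : 'I_n -> C) : normc (\sum_i F i) <= \sum_i normc (F i).
Proof.
elim/big_ind2: _ => //; first by rewrite normc0.
by move=> x1 x2 y1 y2 h1 h2; apply: le_trans (le_normcD _ _) (lerD h1 h2).
Qed.

Lemma normcZr (a : R) : 0 <= a -> normc a%:C%C = a.
Proof. by move=> a0; rewrite /= expr0n addr0 sqrtr_sqr ger0_norm. Qed.

Lemma creB (z z' : C) : cre (z - z') = cre z - cre z'.
Proof. by case: z z' => a b []. Qed.

Lemma cimB (z z' : C) : cim (z - z') = cim z - cim z'.
Proof. by case: z z' => a b []. Qed.

Lemma normc_le_ReIm z : normc z <= `|cre z| + `|cim z|.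
Proof.
case: z => a b /=; rewrite -(@ler_pXn2r _ 2) ?nnegrE ?addr_ge0 ?sqrtr_ge0//.
rewrite sqr_sqrtr ?addr_ge0 ?sqr_ge0// sqrrD !real_normK ?num_real//.
by rewrite addrAC lerDl mulrn_wge0// mulr_ge0.
Qed.

Lemma Re_le_normc z : `|cre z| <= normc z.
Proof.
by case: z => a b /=; rewrite -sqrtr_sqr ler_wsqrtr// lerDl sqr_ge0.
Qed.

Lemma Im_le_normc z : `|cim z| <= normc z.
Proof.
by case: z => a b /=; rewrite -sqrtr_sqr ler_wsqrtr// lerDr sqr_ge0.
Qed.

Definition ip u v : C := \sum_i u i 0 * (v i 0)^*.

Definition vnorm v : R := Num.sqrt (\sum_i normc (v i 0) ^+ 2).

Lemma vnorm_ge0 v : 0 <= vnorm v.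
Proof. exact: sqrtr_ge0. Qed.

Lemma vnorm_sqr v : vnorm v ^+ 2 = \sum_i normc (v i 0) ^+ 2.
Proof. by rewrite sqr_sqrtr// sumr_ge0// => i _; rewrite sqr_ge0. Qed.

Lemma ip_vnorm v : ip v v = (vnorm v ^+ 2)%:C%C.
Proof.
rewrite vnorm_sqr rmorph_sum; apply: eq_bigr => i _.
by rewrite -normCK normr_normc rmorphXn.
Qed.

Lemma normc_ip_self v : normc (ip v v) = vnorm v ^+ 2.
Proof. by rewrite ip_vnorm normcZr ?sqr_ge0. Qed.

Lemma normc_le_vnorm v i : normc (v i 0) <= vnorm v.
Proof.
rewrite -(@ler_pXn2r _ 2) ?nnegrE ?vnorm_ge0 ?normc_ge0// vnorm_sqr.
rewrite (bigD1 i)//= lerDl sumr_ge0// => j _; exact: sqr_ge0.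
Qed.

Lemma vnorm_eq0 v : vnorm v = 0 -> v = 0.
Proof.
move=> v0; apply/colP => i; rewrite mxE; apply: eq0_normc.
by apply/eqP; rewrite -(inj_eq (@complexI R)); apply/eqP/le_anti;
  rewrite !lecR normc_ge0 andbT -v0 normc_le_vnorm.
Qed.

(** Cauchy-Schwarz, reduced to the moduli of the entries. *)
Lemma normc_ip u v : normc (ip u v) <= vnorm u * vnorm v.
Proof.
apply: (le_trans (normc_sum _)).
under eq_bigr do rewrite normcM normc_conj.
rewrite -(@ler_pXn2r _ 2) ?nnegrE ?mulr_ge0 ?vnorm_ge0 ?sumr_ge0//; last first.
  by move=> i _; rewrite mulr_ge0 ?normc_ge0.
rewrite exprMn !vnorm_sqr !big_ord_recl !big_ord0 !addr0.
set a := normc (u _ _); set b := normc (u _ _).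
set c := normc (v _ _); set d := normc (v _ _).
(* Lagrange's identity in dimension two. *)
by rewrite -subr_ge0 [leRHS](_ : _ = (a * d - b * c) ^+ 2) ?sqr_ge0//; ring.
Qed.

(** Write [|u + v|^2 = <u + v, u> + <u + v, v>], apply Cauchy-Schwarz to both terms and divide by
    [|u + v|]. *)
Lemma vnormD u v : vnorm (u + v) <= vnorm u + vnorm v.
Proof.
rewrite -(@ler_pXn2r _ 2) ?nnegrE ?addr_ge0 ?vnorm_ge0//.
have h : vnorm (u + v) ^+ 2 <= normc (ip (u + v) u) + normc (ip (u + v) v).
  have /(congr1 (@normc R)) : ip (u + v) u + ip (u + v) v = (vnorm (u + v) ^+ 2)%:C%C.
    rewrite -ip_vnorm -big_split; apply: eq_bigr => i _ /=.
    by rewrite !mxE rmorphD mulrDr.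
  by rewrite normcZr ?sqr_ge0// => <-; exact: le_normcD.
have h1 := normc_ip (u + v) u; have h2 := normc_ip (u + v) v.
have [e|n] := eqVneq (vnorm (u + v)) 0.
  by rewrite e expr0n sqr_ge0.
have p : 0 < vnorm (u + v) by rewrite lt_def n vnorm_ge0.
have : vnorm (u + v) * vnorm (u + v) <= vnorm (u + v) * (vnorm u + vnorm v).
  by rewrite mulrDr -expr2; apply: le_trans h _; exact: lerD.
rewrite ler_pM2l// => le.
by rewrite ler_pXn2r// nnegrE ?addr_ge0 ?vnorm_ge0.
Qed.

Lemma vnormZ z v : vnorm (z *: v) = normc z * vnorm v.
Proof.
apply: (@pexpIrn _ 2); rewrite ?nnegrE ?mulr_ge0 ?vnorm_ge0 ?normc_ge0//.
rewrite exprMn !vnorm_sqr mulr_sumr; apply: eq_bigr => i _.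
by rewrite mxE normcM exprMn.
Qed.

Lemma vnorm_delta i : vnorm (delta_mx i 0) = 1.
Proof.
rewrite /vnorm (bigD1 i)//= big1 ?addr0 => [|j ji].
  by rewrite mxE !eqxx normc1 expr1n sqrtr1.
by rewrite mxE (negPf ji) normc0 expr0n.
Qed.

Lemma vnorm_le_sum v : vnorm v <= \sum_i normc (v i 0).
Proof.
rewrite -(@ler_pXn2r _ 2) ?nnegrE ?vnorm_ge0 ?sumr_ge0//; last first.
  by move=> i _; exact: normc_ge0.
rewrite vnorm_sqr !big_ord_recl !big_ord0 !addr0 sqrrD -addrA lerD2l lerDr.
by rewrite mulrn_wge0// mulr_ge0 ?normc_ge0.
Qed.

Definition adjm x : 'M[C]_2 := (map_mx Num.conj x)^T.

Lemma ip_adjm x u v : ip (x *m u) v = ip u (adjm x *m v).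
Proof.
rewrite /ip; under eq_bigr do rewrite mxE mulr_suml.
rewrite exchange_big /=; apply: eq_bigr => j _.
rewrite mxE rmorph_sum mulr_sumr; apply: eq_bigr => i _.
by rewrite /= !mxE rmorphM /= conjCK [x i j * _]mulrC mulrA.
Qed.

Lemma adjmK : involutive adjm.
Proof. by move=> x; apply/matrixP => i j; rewrite !mxE conjCK. Qed.

Lemma adjmM x y : adjm (x *m y) = adjm y *m adjm x.
Proof. by rewrite /adjm map_mxM trmx_mul. Qed.

Lemma adjm1 : adjm 1%:M = 1%:M.
Proof. by rewrite /adjm map_mx1 trmx1. Qed.

End HilbertNorm.

(* The unital C*-subalgebras of the algebra of bounded functions [T -> M_2(C)].
   The last axiom is norm closedness, the entrywise and operator norms being
   equivalent on [M_2(C)]. *)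
Record cstar_pred (R : realType) (T : Type) := CstarPred {
  cp_set :> (T -> 'M[R[i]]_2) -> Prop;
  cp1 : cp_set (fun=> 1%:M);
  cpD : forall f g, cp_set f -> cp_set g -> cp_set (fun t => f t + g t);
  cpZ : forall (c : R[i]) f, cp_set f -> cp_set (fun t => c *: f t);
  cpM : forall f g, cp_set f -> cp_set g -> cp_set (fun t => f t *m g t);
  cp_adj : forall f, cp_set f -> cp_set (fun t => adjm (f t));
  cp_bounded : forall f, cp_set f -> exists c : R, forall t i j, normc (f t i j) <= c;
  cp_lim : forall g : T -> 'M[R[i]]_2, (forall e, 0 < e -> exists2 f, cp_set f &
    forall t i j, normc (f t i j - g t i j) <= e) -> cp_set g }.

Record falg (R : realType) (T : Type) (P : cstar_pred R T) := Falg {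
  falg_fun :> T -> 'M[R[i]]_2;
  falgP : P falg_fun }.

(** * The C*-algebra of a closed set of bounded functions into [M_2(C)] *)

Section FunctionAlgebra.
Variables (R : realType) (T : Type) (P : cstar_pred R T).
Local Notation C := R[i].
Local Notation A := (falg P).
Implicit Types f g h : A.

Lemma falg_eq f g : (forall t, f t = g t) -> f = g.
Proof.
case: f g => [f fP] [g gP] /= /funext fg; subst g.
by congr Falg; exact: Prop_irrelevance.
Qed.

HB.instance Definition _ := gen_eqMixin A.
HB.instance Definition _ := gen_choiceMixin A.

Definition falg_add f g := Falg (cpD (falgP f) (falgP g)).
Definition falg_scale c f := Falg (cpZ c (falgP f)).
Definition falg_one := Falg (cp1 P).
(** Taken as a multiple of the unit, whose membership is an axiom of [cstar_pred]. *)
Definition falg_zero := falg_scale 0 falg_one.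
Definition falg_opp f := falg_scale (-1) f.
Definition falg_mul f g := Falg (cpM (falgP f) (falgP g)).
Definition falg_star f := Falg (cp_adj (falgP f)).

Lemma falg_addA : associative falg_add.
Proof. by move=> f g h; apply: falg_eq => t; exact: addrA. Qed.
Lemma falg_addC : commutative falg_add.
Proof. by move=> f g; apply: falg_eq => t; exact: addrC. Qed.
Lemma falg_add0 : left_id falg_zero falg_add.
Proof. by move=> f; apply: falg_eq => t /=; rewrite scale0r add0r. Qed.
Lemma falg_addN : left_inverse falg_zero falg_opp falg_add.
Proof. by move=> f; apply: falg_eq => t /=; rewrite scale0r scaleN1r addNr. Qed.

HB.instance Definition _ :=
  GRing.isZmodule.Build A falg_addA falg_addC falg_add0 falg_addN.

Lemma falgD f g t : (f + g) t = f t + g t. Proof. by []. Qed.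
Lemma falg0 t : (0 : A) t = 0. Proof. exact: scale0r. Qed.
Lemma falgN f t : (- f) t = - f t. Proof. exact: scaleN1r. Qed.
Lemma falgB f g t : (f - g) t = f t - g t. Proof. by rewrite falgD falgN. Qed.

Lemma falg_scaleA c d f : falg_scale c (falg_scale d f) = falg_scale (c * d) f.
Proof. by apply: falg_eq => t; exact: scalerA. Qed.
Lemma falg_scale1 : left_id 1 falg_scale.
Proof. by move=> f; apply: falg_eq => t; exact: scale1r. Qed.
Lemma falg_scaleDr : right_distributive falg_scale +%R.
Proof. by move=> c f g; apply: falg_eq => t; exact: scalerDr. Qed.
Lemma falg_scaleDl f : {morph falg_scale^~ f : a b / a + b}.
Proof. by move=> a b; apply: falg_eq => t; exact: scalerDl. Qed.

HB.instance Definition _ := GRing.Zmodule_isLmodule.Build C A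
  falg_scaleA falg_scale1 falg_scaleDr falg_scaleDl.

Lemma falgZ c f t : (c *: f) t = c *: f t. Proof. by []. Qed.

(** The least such [c] is the supremum over [t] of the operator norms of [f t]. Unlike the largest
    modulus of an entry, it satisfies the C*-identity. *)
Definition opbound f (c : R) :=
  0 <= c /\ forall t v, vnorm (f t *m v) <= c * vnorm v.

(** Each of the two coordinates of [f t *m v] has modulus at most [2 * c * vnorm v], and a vector is
    at most the sum of the moduli of its coordinates. *)
Lemma opbound_entries f (c : R) : 0 <= c ->
  (forall t i j, normc (f t i j) <= c) -> opbound f (4 * c).
Proof.
move=> c0 fc; split; first by rewrite mulr_ge0.
move=> t v; apply: le_trans (vnorm_le_sum _) _.
have h i : normc ((f t *m v) i 0) <= 2 * c * vnorm v.
  rewrite mxE; apply: le_trans (normc_sum _) _.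
  rewrite !big_ord_recl big_ord0 addr0 !normcM.
  have m j : normc (f t i j) * normc (v j 0) <= c * vnorm v.
    by apply: ler_pM; rewrite ?normc_ge0 ?fc ?normc_le_vnorm.
  by have := lerD (m ord0) (m (lift ord0 ord0)); lra.
rewrite !big_ord_recl big_ord0 addr0.
by have := lerD (h ord0) (h (lift ord0 ord0)); lra.
Qed.

Lemma opbound_ex f : exists c, opbound f c.
Proof.
have [c fc] := cp_bounded (falgP f); exists (4 * `|c|).
by apply: opbound_entries => // t i j; apply: le_trans (fc t i j) (ler_norm _).
Qed.

(** The infimum of the bounds is itself a bound: for fixed [t] and [v != 0] the condition says that
    [c] is at least a given quotient, which passes to the infimum. *)
Lemma ex_opnorm f :
  exists c, opbound f c /\ forall c', opbound f c' -> c <= c'.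
Proof.
pose B := [set c | opbound f c]%classic.
have ge (a : R) : (forall c, opbound f c -> a <= c) -> a <= inf B.
  by move=> h; apply: lb_le_inf => //; exact: opbound_ex.
exists (inf B); split; last first.
  by move=> c fc; apply: ge_inf => //; exists 0 => ? [].
split; first by apply: ge => c [].
move=> t v; have [/vnorm_eq0 ->|n] := eqVneq (vnorm v) 0.
  have e : vnorm (0 : 'cV[C]_2) = 0.
    by rewrite -(scale0r (0 : 'cV[C]_2)) vnormZ normc0 mul0r.
  by rewrite mulmx0 e mulr0.
have p : 0 < vnorm v by rewrite lt_def n vnorm_ge0.
by rewrite -ler_pdivrMr//; apply: ge => c [_ h]; rewrite ler_pdivrMr.
Qed.

Definition opnorm f : R := projT1 (cid (ex_opnorm f)).

Lemma opnormP f : opbound f (opnorm f).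
Proof. exact: (projT2 (cid (ex_opnorm f))).1. Qed.

Lemma opnorm_le f (c : R) : opbound f c -> opnorm f <= c.
Proof. exact: (projT2 (cid (ex_opnorm f))).2. Qed.

Lemma opnorm_ge0 f : 0 <= opnorm f.
Proof. by case: (opnormP f). Qed.

Lemma normc_le_opnorm f t i j : normc (f t i j) <= opnorm f.
Proof.
have [_ /(_ t (delta_mx j 0))] := opnormP f; rewrite vnorm_delta mulr1.
apply: le_trans; apply: le_trans (normc_le_vnorm _ i).
by rewrite -colE mxE.
Qed.

Lemma opnorm_eq0 f : opnorm f = 0 -> f = 0.
Proof.
move=> f0; apply: falg_eq => t; rewrite falg0; apply/matrixP => i j.
rewrite mxE; apply: eq0_normc; apply: le_anti.
by rewrite normc_ge0 -f0 normc_le_opnorm.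
Qed.

Lemma opnormD f g : opnorm (f + g) <= opnorm f + opnorm g.
Proof.
have [f0 fP] := opnormP f; have [g0 gP] := opnormP g.
apply: opnorm_le; split=> [|t v]; first exact: addr_ge0.
by rewrite falgD mulmxDl mulrDl; apply: le_trans (vnormD _ _) (lerD _ _).
Qed.

Let opnormZ_le c f : opnorm (c *: f) <= normc c * opnorm f.
Proof.
have [f0 fP] := opnormP f; apply: opnorm_le.
split=> [|t v]; first by rewrite mulr_ge0 ?normc_ge0.
by rewrite falgZ -scalemxAl vnormZ -mulrA ler_wpM2l ?normc_ge0.
Qed.

Lemma opnormZ c f : opnorm (c *: f) = normc c * opnorm f.
Proof.
apply: le_anti; rewrite opnormZ_le andTb.
have [->|c0] := eqVneq c 0; first by rewrite normc0 mul0r opnorm_ge0.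
have n0 : 0 < normc c.
  by rewrite lt_def normc_ge0 andbT; apply: contra c0 => /eqP/eq0_normc ->.
(* The reverse inequality is the direct one applied to [c^-1] and [c *: f]. *)
rewrite -ler_pdivlMl// -normcV; apply: le_trans (opnormZ_le _ _).
by rewrite scalerA mulVf// scale1r.
Qed.

Lemma opnormM f g : opnorm (falg_mul f g) <= opnorm f * opnorm g.
Proof.
have [f0 fP] := opnormP f; have [g0 gP] := opnormP g.
apply: opnorm_le; split=> [|t v]; first exact: mulr_ge0.
rewrite -mulmxA -mulrA; apply: le_trans (fP _ _) _.
by rewrite ler_wpM2l.
Qed.

(* Both inequalities below come from [|x v|^2 = <x^* x v, v>]. *)
Lemma opnorm_star_le f : opnorm (falg_star f) <= opnorm f.
Proof.
have [f0 fP] := opnormP f; apply: opnorm_le; split=> // t v.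
rewrite /=; set w := adjm (f t) *m v.
have [->|n] := eqVneq (vnorm w) 0; first by rewrite mulr_ge0 ?vnorm_ge0.
have p : 0 < vnorm w by rewrite lt_def n vnorm_ge0.
rewrite -(ler_pM2l p) -expr2 -normc_ip_self.
rewrite {2}/w -ip_adjm mulrCA; apply: le_trans (normc_ip _ _) _.
by rewrite mulrA ler_wpM2r ?vnorm_ge0.
Qed.

Lemma falg_starK : involutive falg_star.
Proof. by move=> f; apply: falg_eq => t; exact: adjmK. Qed.

Lemma opnorm_star f : opnorm (falg_mul (falg_star f) f) = opnorm f ^+ 2.
Proof.
apply: le_anti; apply/andP; split.
  apply: le_trans (opnormM _ _) _; rewrite expr2 ler_wpM2r ?opnorm_ge0//.
  exact: opnorm_star_le.
(* Conversely, the square root of the norm of [g] is a bound for [f]. *)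
set g := falg_mul _ _; have [g0 gP] := opnormP g.
rewrite -[leRHS]sqr_sqrtr// ler_pXn2r ?nnegrE ?opnorm_ge0 ?sqrtr_ge0//.
apply: opnorm_le; split=> [|t v]; first exact: sqrtr_ge0.
rewrite -(@ler_pXn2r _ 2) ?nnegrE ?mulr_ge0 ?sqrtr_ge0 ?vnorm_ge0//.
rewrite exprMn (sqr_sqrtr g0) -normc_ip_self ip_adjm mulmxA.
apply: le_trans (normc_ip _ _) _.
by rewrite expr2 mulrA mulrC ler_wpM2r ?vnorm_ge0//; exact: gP.
Qed.

Definition falg_norm f : C := (opnorm f)%:C%C.

Lemma falg_normD f g : falg_norm (f + g) <= falg_norm f + falg_norm g.
Proof. by rewrite -rmorphD lecR opnormD. Qed.

Lemma falg_normZ c f : falg_norm (c *: f) = `|c| * falg_norm f.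
Proof. by rewrite /falg_norm opnormZ rmorphM. Qed.

Lemma falg_norm_eq0 f : falg_norm f = 0 -> f = 0.
Proof. by move=> /complexI /opnorm_eq0. Qed.

HB.instance Definition _ :=
  Lmodule_isNormed.Build C A falg_normD falg_normZ falg_norm_eq0.

Lemma falg_normE f : `|f| = (opnorm f)%:C%C.
Proof. by []. Qed.

Lemma ball_falg f g (e : R) : ball f e%:C%C g <-> opnorm (f - g) < e.
Proof. by rewrite -ball_normE /ball_ /= falg_normE ltcR. Qed.

(** A 1-Lipschitz function carries a Cauchy filter to a convergent one. It serves for the real and
    imaginary parts of the entries, so that completeness comes from that of the real line. *)
Lemma falg_ex_lim (F : set_system A) (u : A -> R) : ProperFilter F ->
  (forall f g, `|u f - u g| <= opnorm (f - g)) -> cauchy F ->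
  exists l : R, forall e : R, 0 < e -> F [set f | `|u f - l| < e]%classic.
Proof.
move=> FF ul /cauchyP Fc.
have : cvg (u @ F)%classic.
  apply/cauchy_cvgP/cauchyP => e e0.
  have [f Ff] := Fc e%:C%C (etrans (ltcR 0 e) e0).
  exists (u f); change (F (u @^-1` ball (u f) e)%classic).
  apply: (@filterS _ F) Ff => g /ball_falg fg; rewrite /= -ball_normE /=.
  exact: le_lt_trans (ul f g) fg.
move=> /cvg_ex[l /= /cvgrPdist_lt ul_l]; exists l => e e0.
have := ul_l e e0; rewrite near_map; apply: filterS => f.
by rewrite distrC.
Qed.

(** The limit [g] is formed entry by entry; the approximation is uniform in [t], so norm closedness
    puts [g] in [P]. *)
Lemma falg_complete (F : set_system A) : ProperFilter F -> cauchy F -> cvg F.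
Proof.
move=> FF Fc.
have Rle t i j f g : `|cre (f t i j) - cre (g t i j)| <= opnorm (f - g).
  rewrite -creB; apply: le_trans (Re_le_normc _) _.
  by have := normc_le_opnorm (f - g) t i j; rewrite falgB !mxE.
have Ile t i j f g : `|cim (f t i j) - cim (g t i j)| <= opnorm (f - g).
  rewrite -cimB; apply: le_trans (Im_le_normc _) _.
  by have := normc_le_opnorm (f - g) t i j; rewrite falgB !mxE.
pose lre t i j := projT1 (cid (falg_ex_lim FF (Rle t i j) Fc)).
pose lim t i j := projT1 (cid (falg_ex_lim FF (Ile t i j) Fc)).
have lreP t i j := projT2 (cid (falg_ex_lim FF (Rle t i j) Fc)).
have limP t i j := projT2 (cid (falg_ex_lim FF (Ile t i j) Fc)).
pose g t : 'M[C]_2 := \matrix_(i, j) Complex (lre t i j) (lim t i j).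
have /cauchyP Fx := Fc.
have near_g e : 0 < e -> exists2 f, F (ball f e%:C%C) &
    forall t i j, normc (f t i j - g t i j) <= 4 * e.
  move=> e0; have [f Ff] := Fx e%:C%C (etrans (ltcR 0 e) e0).
  exists f => // t i j.
  (* The auxiliary [h] depends on [t], [i] and [j], but the resulting bound does not: real and
     imaginary parts each differ by less than [e + e], whence the constant 4. *)
  have [h [/ball_falg fh [hr hi]]] := filter_ex
    (filterI Ff (filterI (lreP t i j e e0) (limP t i j e e0))).
  apply: le_trans (normc_le_ReIm _) _; rewrite creB cimB mxE /=.
  have {}hr : `|cre (h t i j) - lre t i j| < e by exact: hr.
  have {}hi : `|cim (h t i j) - lim t i j| < e by exact: hi.
  have fr := le_lt_trans (Rle t i j f h) fh.
  have fi := le_lt_trans (Ile t i j f h) fh.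
  have r := ler_distD (cre (h t i j)) (cre (f t i j)) (lre t i j).
  have m := ler_distD (cim (h t i j)) (cim (f t i j)) (lim t i j).
  by move: r m hr hi fr fi; lra.
have Pg : P g.
  apply: cp_lim => e e0; have [f _ fg] := near_g (e / 4) (divr_gt0 e0 (ltr0n _ 4)).
  exists f; first exact: falgP.
  by move=> t i j; apply: le_trans (fg t i j) _; rewrite mulrC divfK ?pnatr_eq0.
apply/cvg_ex; exists (Falg Pg).
apply/cvg_ballP => e e0.
(* A positive element of [R[i]] is real. The constant is [4 * 4 + 1]: the entrywise distance [4 * d]
   from [f] to the limit gives [4 * (4 * d)] in operator norm, and [f] is within [d] of [h]. *)
have [d d0 ->] : exists2 d : R, 0 < d & e = (17 * d)%:C%C.
  case: e e0 => a b; rewrite ltcE /= => /andP[/eqP -> a0].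
  exists (a / 17); first by rewrite divr_gt0.
  by rewrite mulrC divfK ?pnatr_eq0.
have [f Ff fg] := near_g d d0; apply: filterS Ff => h /ball_falg fh.
apply/ball_falg; rewrite -(subrK f (Falg Pg)) -addrA.
apply: le_lt_trans (opnormD _ _) _.
have : opnorm (Falg Pg - f) <= 4 * (4 * d).
  apply: opnorm_le; apply: opbound_entries; first by rewrite !mulr_ge0 ?ltW.
  by move=> t i j; have := fg t i j; rewrite -normcN opprB falgB !mxE.
by move: fh; move: (opnorm (Falg Pg - f)) (opnorm (f - h)) => a b; lra.
Qed.

HB.instance Definition _ := Uniform_isComplete.Build A falg_complete.

Lemma falg_mulA : associative falg_mul.
Proof. by move=> f g h; apply: falg_eq => t; exact: mulmxA. Qed.
Lemma falg_mul1l : left_id falg_one falg_mul.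
Proof. by move=> f; apply: falg_eq => t; exact: mul1mx. Qed.
Lemma falg_mul1r : right_id falg_one falg_mul.
Proof. by move=> f; apply: falg_eq => t; exact: mulmx1. Qed.
Lemma falg_mulDl : left_distributive falg_mul +%R.
Proof. by move=> f g h; apply: falg_eq => t; exact: mulmxDl. Qed.
Lemma falg_mulDr : right_distributive falg_mul +%R.
Proof. by move=> f g h; apply: falg_eq => t; exact: mulmxDr. Qed.
Lemma falg_mulZl (c : C) f g : falg_mul (c *: f) g = c *: falg_mul f g.
Proof. by apply: falg_eq => t; rewrite /= -scalemxAl. Qed.
Lemma falg_mulZr (c : C) f g : falg_mul f (c *: g) = c *: falg_mul f g.
Proof. by apply: falg_eq => t; rewrite /= -scalemxAr. Qed.
Lemma falg_starD : {morph falg_star : f g / f + g}.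
Proof.
by move=> f g; apply: falg_eq => t; apply/matrixP => i j; rewrite !mxE rmorphD.
Qed.
Lemma falg_starZ (c : C) f : falg_star (c *: f) = c^* *: falg_star f.
Proof.
by apply: falg_eq => t; apply/matrixP => i j; rewrite !mxE rmorphM.
Qed.
Lemma falg_starM f g : falg_star (falg_mul f g) = falg_mul (falg_star g) (falg_star f).
Proof. by apply: falg_eq => t; exact: adjmM. Qed.
Lemma falg_normM f g : `|falg_mul f g| <= `|f| * `|g|.
Proof. by rewrite !falg_normE -rmorphM lecR opnormM. Qed.
Lemma falg_norm_star f : `|falg_mul (falg_star f) f| = `|f| ^+ 2.
Proof. by rewrite !falg_normE opnorm_star rmorphXn. Qed.

HB.instance Definition _ := isCStarAlgebra.Build R A
  falg_mulA falg_mul1l falg_mul1r falg_mulDl falg_mulDr falg_mulZl falg_mulZr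
  falg_starK falg_starD falg_starZ falg_starM falg_normM falg_norm_star.

End FunctionAlgebra.

(** * Idempotents and [V] *)

Section MinfElements.
Variable S : pzRingType.
Implicit Types (a b : Minf S) (e f x y : S).

Lemma Minf_mul_single a b i j k :
  (forall l, l != k -> a i l * b l j = 0) -> Minf_mul a b i j = a i k * b k j.
Proof.
move=> kP; have [n an] := Minf_fin a.
rewrite (Minf_mulE b i j (bounded_le (leq_maxl n k.+1) an)).
rewrite (bigD1 (Ordinal (leq_maxr n k.+1)))//= big1 ?addr0// => l lk.
exact: kP.
Qed.

Lemma smx_fin e r :
  exists n, bounded n (fun i j : nat => if (i == j) && (i < r)%N then e else 0).
Proof.
exists r => i j h; case: eqP => //= ij; subst j.
by rewrite ltnNge; move: h; rewrite orbb => ->.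
Qed.

Definition smx e r := MkMinf (smx_fin e r).

Lemma smxM e f r q : Minf_mul (smx e r) (smx f q) = smx (e * f) (minn r q).
Proof.
apply: MinfP => i j; rewrite (Minf_mul_single (k := i)) /=.
  rewrite eqxx ltn_min /=.
  by case: (i < r)%N; rewrite /= ?mul0r ?andbF//; case: ifP; rewrite ?mulr0.
by move=> l li; rewrite eq_sym (negPf li) mul0r.
Qed.

Lemma smxD e f r : Minf_add (smx e r) (smx f r) = smx (e + f) r.
Proof. by apply: MinfP => i j /=; case: ifP => // _; rewrite addr0. Qed.

Lemma smx0 r : smx 0 r = @Minf0 S.
Proof. by apply: MinfP => i j /=; case: ifP. Qed.

Lemma smx_idem e r : e * e = e -> Minf_mul (smx e r) (smx e r) = smx e r.
Proof. by move=> ee; rewrite smxM ee minnn. Qed.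

(** Total in [e], with junk value 0 when [e] is not idempotent, so that [e] can be rewritten without
    carrying a proof. *)
Definition V_smx e r : V S :=
  if pselect (e * e = e) is left ee then V_class (MkIdem (smx_idem r ee)) else 0.

Definition V_elt e : V S := V_smx e 1.

Lemma V_smxE e r (a : idem S) : e * e = e -> a = smx e r :> Minf S ->
  V_class a = V_smx e r.
Proof.
move=> ee aE; rewrite /V_smx; case: pselect => // ee'.
by congr V_class; apply: idem_inj.
Qed.

Lemma V_class_smx e r (ee : e * e = e) :
  V_class (MkIdem (smx_idem r ee)) = V_smx e r.
Proof. exact: V_smxE. Qed.

Lemma V_smx_equiv e f r q : e * e = e -> f * f = f ->
  idem_equiv (smx e r) (smx f q) -> V_smx e r = V_smx f q.
Proof.
move=> ee ff ef.
rewrite -(V_class_smx r ee).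
by rewrite -(V_class_smx q ff); apply/V_classP.
Qed.

Lemma V_elt_equiv e f x y : e * e = e -> f * f = f ->
  e = x * y -> f = y * x -> V_elt e = V_elt f.
Proof.
move=> ee ff exy fyx; apply: V_smx_equiv => //.
by exists (smx x 1), (smx y 1); rewrite !smxM -exy -fyx minnn.
Qed.

Lemma V_smxD e f r : e * e = e -> f * f = f -> e * f = 0 -> f * e = 0 ->
  V_smx (e + f) r = V_smx e r + V_smx f r.
Proof.
move=> ee ff ef fe.
have efef : (e + f) * (e + f) = e + f.
  by rewrite mulrDl !mulrDr ee ff ef fe addr0 add0r.
rewrite -(V_class_smx r ee).
rewrite -(V_class_smx r ff).
rewrite -(V_class_smx r efef); symmetry.
apply: V_addE_orth; last exact: esym (smxD e f r).
  by rewrite [LHS]smxM ef smx0.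
by rewrite [LHS]smxM fe smx0.
Qed.

Lemma emx_fin i j x : exists n,
  bounded n (fun k l : nat => if (k == i) && (l == j) then x else 0).
Proof.
exists (maxn i j).+1 => k l /orP[] h; case: ifP => // /andP[/eqP ki /eqP lj].
  by move: h; rewrite ki leqNgt ltnS leq_maxl.
by move: h; rewrite lj leqNgt ltnS leq_maxr.
Qed.

Definition emx i j x := MkMinf (emx_fin i j x).

Lemma emxM i j l x y : Minf_mul (emx i j x) (emx j l y) = emx i l (x * y).
Proof.
apply: MinfP => s t; rewrite (Minf_mul_single (k := j)) /=.
  by rewrite eqxx andbT; case: (s == i); case: (t == l); rewrite ?mul0r ?mulr0.
by move=> m mj; rewrite (negPf mj) andbF mul0r.
Qed.

(** The last diagonal entry splits off as an orthogonal idempotent, and the matrix units [emx r 0 e]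
    and [emx 0 r e] move it to the corner. *)
Lemma V_smx_nat e r : e * e = e -> V_smx e r = V_elt e *+ r.
Proof.
move=> ee; elim: r => [|r IH].
  rewrite mulr0n -(V_smxE (e := e) (r := 0) (a := idem0 S))//.
  by apply: MinfP => i j /=; rewrite ltn0 andbF.
have rr : Minf_mul (emx r r e) (emx r r e) = emx r r e by rewrite emxM ee.
have rE : V_class (MkIdem rr) = V_elt e.
  rewrite /V_elt -(V_class_smx 1 ee).
  apply/V_classP; exists (emx r 0 e), (emx 0 r e); rewrite !emxM ee; split=> //.
  by apply: MinfP => -[|i] [|j]//=; rewrite andbF.
rewrite mulrSr -IH -rE -(V_class_smx r ee) -(V_class_smx r.+1 ee); symmetry.
apply: V_addE_orth => /=; apply: MinfP => i j.
- rewrite (Minf_mul_single (k := r)) /=.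
    by case: eqP => [->|]; rewrite ?ltnn mul0r.
  by move=> l lr; rewrite (negPf lr) mulr0.
- rewrite (Minf_mul_single (k := r)) /=.
    by rewrite ltnn andbF mulr0.
  by move=> l lr; rewrite (negPf lr) andbF mul0r.
- rewrite /= ltnS leq_eqVlt; have [<-|ij] := eqVneq i j; last first.
    rewrite /= add0r; case: ifP => // /andP[/eqP ir /eqP jr].
    by rewrite ir jr eqxx in ij.
  by have [->|ir] := eqVneq i r; rewrite /= ?ltnn ?add0r ?addr0.
Qed.

Lemma V_elt1 : V_elt 1 = V_unit S.
Proof.
symmetry; apply: V_smxE; first exact: mulr1.
apply: MinfP => i j /=; rewrite /mx_entry.
case: insubP => [i' _ <-|]; last by case: i => //= i; rewrite ltnS ltn0 andbF.
case: insubP => [j' _ <-|]; first by rewrite mxE !ord1.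
by rewrite ord1; case: j.
Qed.

(** * Traces as additive invariants on [V] *)

Section Trace.
Variables (K : zmodType) (tau : S -> K).
Hypotheses (tauD : {morph tau : x y / x + y}) (tauC : forall x y, tau (x * y) = tau (y * x)).

Let tau0 : tau 0 = 0.
Proof. by apply: (addrI (tau 0)); rewrite -tauD !addr0. Qed.

Let tau_sum n (F : 'I_n -> S) : tau (\sum_(i < n) F i) = \sum_(i < n) tau (F i).
Proof. exact: (big_morph tau tauD tau0). Qed.

Definition Minf_trace a : K := \sum_(i < projT1 (cid (Minf_fin a))) tau (a i i).

Lemma Minf_traceE n a : bounded n a -> Minf_trace a = \sum_(i < n) tau (a i i).
Proof.
rewrite /Minf_trace; case: cid => m am an /=.
have E k l : bounded k a -> (k <= l)%N ->
    \sum_(i < k) tau (a i i) = \sum_(i < l) tau (a i i).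
  move=> ak kl; rewrite (big_ord_widen l (fun i => tau (a i i)) kl) big_mkcond.
  apply: eq_bigr => i _; case: ltnP => // ki; by rewrite ak ?ki.
by rewrite (E _ _ am (leq_maxl m n)) (E _ _ an (leq_maxr m n)).
Qed.

Lemma Minf_traceC a b : Minf_trace (Minf_mul a b) = Minf_trace (Minf_mul b a).
Proof.
have [n [an bn]] := bounded2 a b.
have bd (c d : Minf S) : bounded n c -> bounded n d -> bounded n (Minf_mul c d).
  move=> cn dn i j h; rewrite (Minf_mulE _ _ _ cn) big1// => k _.
  by case/orP: h => h; [rewrite cn ?h ?mul0r|rewrite dn ?h ?orbT ?mulr0].
rewrite !(Minf_traceE (bd _ _ _ _))//.
under eq_bigr => i _ do rewrite (Minf_mulE _ _ _ an) tau_sum.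
under [RHS]eq_bigr => i _ do rewrite (Minf_mulE _ _ _ bn) tau_sum.
by rewrite exchange_big; apply: eq_bigr => i _; apply: eq_bigr => j _.
Qed.

(** The trace identity for [tau] gives the one for matrices, hence invariance under [x y ~ y x].
    These invariants will show that multiples of the basic classes are distinct. *)
Definition V_trace (u : V S) : K := Minf_trace (repr u).

Lemma V_trace_class (a : idem S) : V_trace (V_class a) = Minf_trace a.
Proof.
have /V_classP[x [y [rE aE]]] := V_classK (V_class a).
by rewrite /V_trace aE; transitivity (Minf_trace (Minf_mul x y));
  [congr Minf_trace|exact: Minf_traceC].
Qed.

Lemma V_trace_elt e : e * e = e -> V_trace (V_elt e) = tau e.
Proof.
move=> ee; rewrite /V_elt -(V_class_smx 1 ee).
rewrite V_trace_class (@Minf_traceE 1) ?big_ord1//= => i j h.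
case: eqP => //= ij; subst j; rewrite orbb in h.
by rewrite ltnNge h.
Qed.

Lemma V_traceD u v : V_trace (u + v) = V_trace u + V_trace v.
Proof.
rewrite -[u]V_classK -[v]V_classK; move: (repr u) (repr v) => a b.
rewrite V_addE !V_trace_class; have [n [an bn]] := bounded2 a b.
rewrite (Minf_traceE (bounded_dsum an bn)) (Minf_traceE an) (Minf_traceE bn).
elim: n {an bn} => [|n IH]; first by rewrite !big_ord0 addr0.
rewrite doubleS !big_ord_recr /= {}IH eqxx odd_double /= uphalf_double doubleK.
by rewrite !addrA; congr (_ + _); rewrite -!addrA; congr (_ + _); rewrite addrC.
Qed.

Lemma V_traceMn u n : V_trace (u *+ n) = V_trace u *+ n.
Proof.
elim: n => [|n IH]; last by rewrite !mulrS V_traceD IH.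
by apply: (addrI (V_trace u)); rewrite -V_traceD !mulr0n !addr0.
Qed.

End Trace.

End MinfElements.

Lemma V_map_elt (S S' : pzRingType) (f : {rmorphism S -> S'}) (e : S) :
  e * e = e -> V_map f (V_elt e) = V_elt (f e).
Proof.
move=> ee; rewrite /V_elt -(V_class_smx 1 ee).
rewrite V_map_class; apply: V_smxE; first by rewrite -rmorphM ee.
by apply: MinfP => i j /=; case: ifP => // _; rewrite rmorph0.
Qed.

Lemma V_mapMn (S S' : pzRingType) (f : {rmorphism S -> S'}) u n :
  V_map f (u *+ n) = V_map f u *+ n.
Proof.
have [f0 fD] := V_map_morph f.
by elim: n => [|n IH]; rewrite ?mulr0n ?f0// !mulrS fD IH.
Qed.

Lemma idem_equiv_mx (S : pzRingType) n (M N X Y : 'M[S]_n) :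
  M = X *m Y -> N = Y *m X -> idem_equiv (Minf_of_mx M) (Minf_of_mx N).
Proof.
by move=> -> ->; exists (Minf_of_mx X), (Minf_of_mx Y); rewrite !Minf_of_mxM.
Qed.

Lemma idem_mx_ex (S : pzRingType) (a : idem S) :
  exists n (M : 'M[S]_n), a = Minf_of_mx M :> Minf S /\ M *m M = M.
Proof.
have [n an] := Minf_fin a; have aM := Minf_of_mxK an.
exists n, (\matrix_(i, j) a i j); split=> //.
apply/matrixP => i j; rewrite -[LHS]Minf_of_mxE -[RHS]Minf_of_mxE Minf_of_mxM.
by rewrite -aM idemP.
Qed.

Lemma V_ex_mx (S : pzRingType) (u : V S) :
  exists n (M : 'M[S]_n) (MM : M *m M = M), u = V_class (idem_of_mx MM).
Proof.
have [n [M [uM MM]]] := idem_mx_ex (repr u); exists n, M, MM.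
by rewrite -[LHS]V_classK; congr V_class; exact: idem_inj.
Qed.

(** The products [E (1 - E)] and [(1 - F) F] vanish, so one summand of [W] survives on either side.
    Where [W] is invertible, it conjugates [F] into [E]. *)
Lemma idem_intertwine (S : pzRingType) n (E F : 'M[S]_n) :
  E *m E = E -> F *m F = F ->
  let W := E *m F + (1%:M - E) *m (1%:M - F) in
  E *m W = E *m F /\ W *m F = E *m F.
Proof.
move=> EE FF /=; split.
  by rewrite mulmxDr !mulmxA EE (mulmxBr E) mulmx1 EE subrr mul0mx addr0.
by rewrite mulmxDl -!mulmxA FF (mulmxBl _ _ F) mul1mx FF subrr mulmx0 addr0.
Qed.

(** The rank factorisation is [D = L p U] with [L], [U] invertible and [p] the partial identity.
    Cancelling [L] and [U] in [D D = D] gives [p U L p = p], so [X = L p] and [Y = p U] work. *)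
Lemma idem_mx_equiv_pid (K : fieldType) n (D : 'M[K]_n) : D *m D = D ->
  exists r (X Y : 'M[K]_n), [/\ D = X *m Y, pid_mx r = Y *m X & (r <= n)%N].
Proof.
set r := \rank D; set p : 'M[K]_n := pid_mx r => DD.
have rn : (r <= n)%N := rank_leq_row D.
have pp : p *m p = p by exact: pid_mx_id.
have LU := mulmx_ebase D; move: (col_ebase_unit D) (row_ebase_unit D) LU.
move: (col_ebase D) (row_ebase D) => L U Lu Uu LU.
exists r, (L *m p), (p *m U); split=> //.
  by rewrite -mulmxA (mulmxA p p U) pp mulmxA.
move: DD; rewrite -LU -/r -/p => DD.
apply: (can_inj (mulKmx Lu)); apply: (can_inj (mulmxK Uu)).
by rewrite -[LHS]DD !mulmxA.
Qed.

Lemma surj_inj_bij (T U : Type) (f : T -> U) :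
  injective f -> (forall u, exists x, u = f x) -> bijective f.
Proof.
move=> fi fs; pose g u := projT1 (cid (fs u)).
have fg u : f (g u) = u by rewrite -(projT2 (cid (fs u))).
by exists g => // x; apply: fi.
Qed.

(** Lets the isomorphism be built from the combinatorial diagram to the lifted one, where it has an
    explicit formula. *)
Lemma ou_diagram_iso_inv (d : Order.disp_t) (P : porderType d) (D E : ou_diagram P)
    (f : forall p, E p -> D p) :
  (forall p, nmod_morphism (f p)) -> (forall p, f p (ou_unit (E p)) = ou_unit (D p)) ->
  (forall p, bijective (f p)) ->
  (forall p q (pq : (p <= q)%O) x, f q (oud_map E pq x) = oud_map D pq (f p x)) ->
  ou_diagram_iso D E.
Proof.
move=> fD fu fb fn.
have ex p : exists g, cancel (f p) g /\ cancel g (f p).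
  by have [g] := fb p; exists g.
pose g p := projT1 (cid (ex p)).
have fK p : cancel (f p) (g p) := (projT2 (cid (ex p))).1.
have gK p : cancel (g p) (f p) := (projT2 (cid (ex p))).2.
have gD p : nmod_morphism (g p).
  split=> [|u v]; apply: (can_inj (fK p)); rewrite gK; first by rewrite (fD p).1.
  by rewrite (fD p).2 !gK.
have gu p : g p (ou_unit (D p)) = ou_unit (E p) by rewrite -fu fK.
exists (fun p => OUHom (gD p) (gu p)); split=> [p|p q pq x] /=.
  by exists (f p).
by apply: (can_inj (fK q)); rewrite gK fn gK.
Qed.

(** * Continuity of complex functions *)

Section ComplexContinuity.
Variables (R : realType) (T : topologicalType).
Local Notation C := R[i].
Implicit Types (f g : T -> C).

(** Phrased through the two parts, so that everything reduces to continuity of real functions. *)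
Definition ccont f := continuous (cre \o f) /\ continuous (cim \o f).

Lemma ccont_eq f g : (forall t, f t = g t) -> ccont f -> ccont g.
Proof. by move=> /funext ->. Qed.

Lemma ccont_cst (c : C) : ccont (fun=> c).
Proof. by split=> t; exact: cvg_cst. Qed.

Lemma ccontD f g : ccont f -> ccont g -> ccont (fun t => f t + g t).
Proof.
move=> [fr fi] [gr gi]; split.
  suff -> : cre \o (fun t => f t + g t) = (cre \o f) + (cre \o g).
    by move=> t; apply: cvgD; [exact: fr|exact: gr].
  by apply/funext => t /=; rewrite [in RHS]/GRing.add/=; case: (f t) (g t) => a b [].
suff -> : cim \o (fun t => f t + g t) = (cim \o f) + (cim \o g).
  by move=> t; apply: cvgD; [exact: fi|exact: gi].
by apply/funext => t /=; rewrite [in RHS]/GRing.add/=; case: (f t) (g t) => a b [].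
Qed.

Lemma ccontM f g : ccont f -> ccont g -> ccont (fun t => f t * g t).
Proof.
move=> [fr fi] [gr gi]; split.
  suff -> : cre \o (fun t => f t * g t) =
      (cre \o f) \* (cre \o g) - (cim \o f) \* (cim \o g).
    by move=> t; apply: cvgB; apply: cvgM; [exact: fr|exact: gr|exact: fi|exact: gi].
  by apply/funext => t /=; rewrite !fctE /=; case: (f t) (g t) => a b [].
suff -> : cim \o (fun t => f t * g t) =
    (cre \o f) \* (cim \o g) + (cim \o f) \* (cre \o g).
  by move=> t; apply: cvgD; apply: cvgM; [exact: fr|exact: gi|exact: fi|exact: gr].
by apply/funext => t /=; rewrite !fctE /=; case: (f t) (g t) => a b [].
Qed.

Lemma ccont_conj f : ccont f -> ccont (fun t => (f t)^* ).
Proof.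
move=> [fr fi]; split.
  suff -> : cre \o (fun t => (f t)^* ) = cre \o f by [].
  by apply/funext => t /=; case: (f t).
suff -> : cim \o (fun t => (f t)^* ) = - (cim \o f).
  by move=> t; apply: cvgN; exact: fi.
by apply/funext => t /=; rewrite !fctE /=; case: (f t).
Qed.

Lemma ccont_real (u : T -> R) : continuous u -> ccont (fun t => (u t)%:C%C).
Proof. by move=> uc; split=> // t; exact: cvg_cst. Qed.

Lemma normc_sqr (z : C) : normc z ^+ 2 = cre z ^+ 2 + cim z ^+ 2.
Proof. by case: z => a b /=; rewrite sqr_sqrtr// addr_ge0// sqr_ge0. Qed.

Lemma continuous_normc_sqr f : ccont f -> continuous (fun t => normc (f t) ^+ 2).
Proof.
move=> [fr fi].
suff -> : (fun t => normc (f t) ^+ 2) =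
    (cre \o f) \* (cre \o f) + (cim \o f) \* (cim \o f).
  by move=> t; apply: cvgD; apply: cvgM; [exact: fr|exact: fr|exact: fi|exact: fi].
by apply/funext => t; rewrite normc_sqr.
Qed.

(** The inverse is the conjugate divided by the squared modulus, which is polynomial in the real and
    imaginary parts. *)
Lemma ccontV f : (forall t, f t != 0) -> ccont f -> ccont (fun t => (f t)^-1).
Proof.
move=> f0 fc; have nc := continuous_normc_sqr fc.
have n0 t : normc (f t) ^+ 2 != 0.
  by rewrite expf_eq0 /=; apply: contra (f0 t) => /eqP/eq0_normc ->.
apply: (@ccont_eq (fun t => ((normc (f t) ^+ 2)^-1)%:C%C * (f t)^* )).
  by move=> t; rewrite invc_norm normr_normc fmorphV rmorphXn.
apply: ccontM; last exact: ccont_conj.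
by apply: ccont_real => t; apply: cvgV; [exact: n0|exact: nc].
Qed.

Lemma ccont_sum (I : Type) (r : seq I) (P : pred I) (F : I -> T -> C) :
  (forall i, ccont (F i)) -> ccont (fun t => \sum_(i <- r | P i) F i t).
Proof.
move=> Fc; elim: r => [|i r IH].
  by apply: ccont_eq (ccont_cst 0) => t; rewrite big_nil.
case Pi: (P i); last by apply: ccont_eq IH => t; rewrite big_cons Pi.
by apply: ccont_eq (ccontD (Fc i) IH) => t; rewrite big_cons Pi.
Qed.

Lemma ccont_prod (I : Type) (r : seq I) (P : pred I) (F : I -> T -> C) :
  (forall i, ccont (F i)) -> ccont (fun t => \prod_(i <- r | P i) F i t).
Proof.
move=> Fc; elim: r => [|i r IH].
  by apply: ccont_eq (ccont_cst 1) => t; rewrite big_nil.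
case Pi: (P i); last by apply: ccont_eq IH => t; rewrite big_cons Pi.
by apply: ccont_eq (ccontM (Fc i) IH) => t; rewrite big_cons Pi.
Qed.

Definition mxcont m n (Z : T -> 'M[C]_(m, n)) := forall i j, ccont (fun t => Z t i j).

Lemma mxcont_cst m n (A : 'M[C]_(m, n)) : mxcont (fun=> A).
Proof. by move=> i j; exact: ccont_cst. Qed.

Lemma mxcontD m n (Z W : T -> 'M[C]_(m, n)) :
  mxcont Z -> mxcont W -> mxcont (fun t => Z t + W t).
Proof. by move=> Zc Wc i j; apply: ccont_eq (ccontD (Zc i j) (Wc i j)) => t; rewrite mxE. Qed.

Lemma mxcontZ m n c (Z : T -> 'M[C]_(m, n)) : mxcont Z -> mxcont (fun t => c *: Z t).
Proof.
by move=> Zc i j; apply: ccont_eq (ccontM (ccont_cst c) (Zc i j)) => t; rewrite mxE.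
Qed.

Lemma mxcontB m n (Z W : T -> 'M[C]_(m, n)) :
  mxcont Z -> mxcont W -> mxcont (fun t => Z t - W t).
Proof.
move=> Zc Wc i j; apply: ccont_eq (mxcontD Zc (mxcontZ (-1) Wc) i j) => t.
by rewrite scaleN1r.
Qed.

Lemma mxcontM m n p (Z : T -> 'M[C]_(m, n)) (W : T -> 'M[C]_(n, p)) :
  mxcont Z -> mxcont W -> mxcont (fun t => Z t *m W t).
Proof.
move=> Zc Wc i j; apply: (@ccont_eq (fun t => \sum_k Z t i k * W t k j)).
  by move=> t; rewrite mxE.
by apply: ccont_sum => k; exact: ccontM.
Qed.

Lemma mxcont_det n (Z : T -> 'M[C]_n) : mxcont Z -> ccont (fun t => \det (Z t)).
Proof.
move=> Zc; apply: ccont_sum => s; apply: ccontM; first exact: ccont_cst.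
by apply: ccont_prod => i; exact: Zc.
Qed.

(** Cramer's rule: the entries of the inverse are cofactors divided by the determinant. *)
Lemma mxcont_inv n (Z : T -> 'M[C]_n) : (forall t, Z t \in unitmx) ->
  mxcont Z -> mxcont (fun t => invmx (Z t)).
Proof.
move=> Zu Zc i j.
apply: (@ccont_eq (fun t => (\det (Z t))^-1 * cofactor (Z t) j i)).
  by move=> t; rewrite /invmx Zu !mxE.
apply: ccontM.
  by apply: ccontV; [move=> t; rewrite -unitfE -unitmxE|exact: mxcont_det].
apply: ccontM; first exact: ccont_cst.
by apply: mxcont_det => k l; apply: ccont_eq (Zc (lift j k) (lift i l)) => t; rewrite !mxE.
Qed.

End ComplexContinuity.

Lemma ccont_comp (R : realType) (T U : topologicalType) (h : U -> T) (f : T -> R[i]) :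
  continuous h -> ccont f -> ccont (f \o h).
Proof.
move=> hc [fr fi]; split=> t.
  exact: (@continuous_comp _ _ _ h (cre \o f) t (hc t) (fr (h t))).
exact: (@continuous_comp _ _ _ h (cim \o f) t (hc t) (fi (h t))).
Qed.

Lemma mxcont_comp (R : realType) (T U : topologicalType) m n (h : U -> T)
  (Z : T -> 'M[R[i]]_(m, n)) : continuous h -> mxcont Z -> mxcont (Z \o h).
Proof. by move=> hc Zc i j; exact: (ccont_comp hc (Zc i j)). Qed.

(** The set where [v] equals [v 0] is open, and so is its complement; [V] carries no topology. *)
Lemma locally_constant (R : realType) (V : Type) (v : R -> V) :
  (forall s0, \forall s \near s0, v s = v s0) -> forall s, v s = v 0.
Proof.
move=> vl; suff : [set s | v s = v 0]%classic = setT.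
  by move=> e s; have : [set: R]%classic s by []; rewrite -e.
have /connected_intervalP c : is_interval [set: R]%classic by [].
apply: c; first by exists 0.
- exists [set s | v s = v 0]%classic; last by rewrite setTI.
  rewrite openE => s /= vs; have := vl s; rewrite /interior/=.
  by apply: filterS => t /= ->.
- exists [set s | v s = v 0]%classic; last by rewrite setTI.
  rewrite -[X in closed X]setCK; apply: open_closedC.
  rewrite openE => s /= vs; have := vl s; rewrite /interior/=.
  by apply: filterS => t vt vt0; apply: vs; rewrite -vt.
Qed.

(** * Matrices over algebras of functions into [M_2(C)] *)

Section Blocks.
Variables (R : realType) (T : Type) (P : cstar_pred R T) (n : nat).
Local Notation C := R[i].
Local Notation A := (cring (falg P)).

(** The coordinate in [C^2] is the outer index, so that a matrix with diagonal cells becomes block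
    diagonal with two blocks of size [n]. *)
Definition blk_ord (r : 'I_2) (i : 'I_n) : 'I_(n + n) :=
  if r == 0 then lshift n i else rshift n i.

Definition ord_blk (k : 'I_(n + n)) : 'I_2 * 'I_n :=
  match fintype.split k with inl i => (0, i) | inr i => (1, i) end.

Lemma blk_ordK r i : ord_blk (blk_ord r i) = (r, i).
Proof.
rewrite /ord_blk /blk_ord; case: (eqVneq r 0) => [->|r0].
  by rewrite -[lshift n i]/(unsplit (inl i)) unsplitK.
rewrite -[rshift n i]/(unsplit (inr i)) unsplitK; congr pair.
by apply: val_inj; case: r r0 => -[|[|r]].
Qed.

Lemma ord_blkP k : exists r i, k = blk_ord r i.
Proof.
rewrite -(fintype.splitK k); case: (fintype.split k) => i; first by exists 0, i.
by exists 1, i.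
Qed.

Lemma sum_blk_ord (V : nmodType) (F : 'I_(n + n) -> V) :
  \sum_k F k = \sum_i \sum_r F (blk_ord r i).
Proof.
rewrite big_split_ord /= -big_split /=; apply: eq_bigr => i _.
by rewrite !big_ord_recl big_ord0 addr0.
Qed.

(* [M_n] over the functions into [M_2(C)] is identified with functions into
   [M_{2n}(C)], the row [r] of the block row [i] being the row [i + r n]. *)
Definition blk (M : 'M[A]_n) (t : T) : 'M[C]_(n + n) :=
  \matrix_(k, l) (M (ord_blk k).2 (ord_blk l).2 : falg P) t (ord_blk k).1 (ord_blk l).1.

Definition cell (Z : 'M[C]_(n + n)) i j : 'M[C]_2 :=
  \matrix_(r, s) Z (blk_ord r i) (blk_ord s j).

Lemma blkE M t r s i j :
  blk M t (blk_ord r i) (blk_ord s j) = (M i j : falg P) t r s.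
Proof. by rewrite mxE !blk_ordK. Qed.

Lemma cell_blk M t i j : cell (blk M t) i j = (M i j : falg P) t.
Proof. by apply/matrixP => r s; rewrite mxE blkE. Qed.

Lemma cell_inj Z Z' : (forall i j, cell Z i j = cell Z' i j) -> Z = Z'.
Proof.
move=> ZZ; apply/matrixP => k l.
have [r [i ->]] := ord_blkP k; have [s [j ->]] := ord_blkP l.
by have /matrixP/(_ r s) := ZZ i j; rewrite !mxE.
Qed.

Lemma blk_inj M N : (forall t, blk M t = blk N t) -> M = N.
Proof.
move=> MN; apply/matrixP => i j; apply: falg_eq => t.
by rewrite -!cell_blk MN.
Qed.

Lemma falg_sum (I : Type) (r : seq I) (F : I -> A) t :
  ((\sum_(i <- r) F i : A) : falg P) t = \sum_(i <- r) (F i : falg P) t.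
Proof.
elim: r => [|i r IH]; first by rewrite !big_nil falg0.
by rewrite !big_cons -IH.
Qed.

Lemma blkM M N t : blk (M *m N) t = blk M t *m blk N t.
Proof.
apply/matrixP => k l; have [r [i ->]] := ord_blkP k; have [s [j ->]] := ord_blkP l.
rewrite blkE mxE falg_sum summxE [RHS]mxE sum_blk_ord.
apply: eq_bigr => m _; rewrite mxE; apply: eq_bigr => q _.
by rewrite !blkE.
Qed.

Lemma blkD M N t : blk (M + N) t = blk M t + blk N t.
Proof. by apply/matrixP => k l; rewrite !mxE. Qed.

Lemma blkB M N t : blk (M - N) t = blk M t - blk N t.
Proof.
apply: cell_inj => i j; rewrite cell_blk !mxE; apply/matrixP => r s.
have -> : ((M i j - N i j : A) : falg P) t = (M i j : falg P) t - (N i j : falg P) t.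
  exact: falgB.
by rewrite !mxE !blk_ordK.
Qed.

Lemma blk_ord_eq r s i j : (blk_ord r i == blk_ord s j) = (r == s) && (i == j).
Proof.
apply/eqP/andP => [/(congr1 ord_blk)|[/eqP -> /eqP ->]//].
by rewrite !blk_ordK => -[-> ->].
Qed.

Lemma blk1 t : blk 1%:M t = 1%:M.
Proof.
apply: cell_inj => i j; rewrite cell_blk; apply/matrixP => r s.
rewrite !mxE blk_ord_eq; case: (i == j); last by rewrite falg0 mxE andbF.
by rewrite andbT mulr1n mxE.
Qed.

Lemma blk_intertwiner M N t :
  blk (M *m N + (1%:M - M) *m (1%:M - N)) t =
  blk M t *m blk N t + (1%:M - blk M t) *m (1%:M - blk N t).
Proof. by rewrite blkD blkM blkM blkB blkB blk1. Qed.

Lemma blk_ex (Z : T -> 'M[C]_(n + n)) :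
  (forall i j, P (fun t => cell (Z t) i j)) -> exists M, forall t, blk M t = Z t.
Proof.
move=> ZP; exists (\matrix_(i, j) (Falg (ZP i j) : A)) => t.
by apply: cell_inj => i j; rewrite cell_blk mxE.
Qed.


End Blocks.

Lemma ord2P (r : 'I_2) : r = 0 \/ r = 1.
Proof. by case: r => -[|[|]]//= h; [left|right]; apply: val_inj. Qed.

(** * Subalgebras of [M_2(C)] and the algebras at the vertices *)

Section DiagonalMatrices.
Variable R : realType.
Local Notation C := R[i].
Implicit Types (x y z w : C) (M N : 'M[C]_2).

Definition dmx x y : 'M[C]_2 :=
  \matrix_(r, s) if r == s then if r == 0 then x else y else 0.

Lemma mx2P M N : M 0 0 = N 0 0 -> M 0 1 = N 0 1 -> M 1 0 = N 1 0 ->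
  M 1 1 = N 1 1 -> M = N.
Proof.
move=> h1 h2 h3 h4; apply/matrixP => r s.
by case: (ord2P r) => ->; case: (ord2P s) => ->.
Qed.

Lemma mul2E M N r s : (M *m N) r s = M r 0 * N 0 s + M r 1 * N 1 s.
Proof.
rewrite mxE !big_ord_recl big_ord0 addr0; congr (_ + M _ _ * N _ _);
  exact: val_inj.
Qed.

Lemma dmxM x y z w : dmx x y *m dmx z w = dmx (x * z) (y * w).
Proof.
by apply: mx2P; rewrite mul2E !mxE /= ?mul0r ?mulr0 ?addr0 ?add0r.
Qed.

Lemma dmxD x y z w : dmx x y + dmx z w = dmx (x + z) (y + w).
Proof. by apply: mx2P; rewrite !mxE /= ?addr0. Qed.

Lemma dmxZ z x y : z *: dmx x y = dmx (z * x) (z * y).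
Proof. by apply: mx2P; rewrite !mxE /= ?mulr0. Qed.

Lemma dmx1 : dmx 1 1 = 1%:M.
Proof. by apply: mx2P; rewrite !mxE. Qed.

Lemma dmx0 : dmx 0 0 = 0.
Proof. by apply: mx2P; rewrite !mxE. Qed.

Lemma dmx_adj x y : adjm (dmx x y) = dmx x^* y^*.
Proof. by apply: mx2P; rewrite !mxE /= ?rmorph0. Qed.

Lemma dmxP M : M 0 1 = 0 -> M 1 0 = 0 -> M = dmx (M 0 0) (M 1 1).
Proof. by move=> h k; apply: mx2P; rewrite !mxE. Qed.

Lemma normc_lt_eq0 z : (forall e, 0 < e -> normc z <= e) -> z = 0.
Proof.
move=> h; apply: eq0_normc; apply/eqP; rewrite eq_le normc_ge0 andbT.
by apply/ler_addgt0Pr => e e0; rewrite add0r h.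
Qed.

Definition is_close e M N := forall i j, normc (M i j - N i j) <= e.

(** The unital C*-subalgebras of [M_2(C)], the possible sets of values of the constant functions. *)
Record mx_star := MxStar {
  ms_set :> 'M[C]_2 -> Prop;
  ms1 : ms_set 1%:M;
  msD : forall M N, ms_set M -> ms_set N -> ms_set (M + N);
  msZ : forall z M, ms_set M -> ms_set (z *: M);
  msM : forall M N, ms_set M -> ms_set N -> ms_set (M *m N);
  ms_adj : forall M, ms_set M -> ms_set (adjm M);
  ms_lim : forall N,
    (forall e, 0 < e -> exists2 M, ms_set M & is_close e M N) -> ms_set N }.

Definition full_ms : mx_star.
Proof. by exists (fun=> True). Defined.

Definition diag_ms : mx_star.
Proof.
exists (fun M => exists x y, M = dmx x y).
- by exists 1, 1; rewrite dmx1.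
- by move=> M N [x [y ->]] [z [w ->]]; rewrite dmxD; exists (x + z), (y + w).
- by move=> c M [x [y ->]]; rewrite dmxZ; exists (c * x), (c * y).
- by move=> M N [x [y ->]] [z [w ->]]; rewrite dmxM; exists (x * z), (y * w).
- by move=> M [x [y ->]]; rewrite dmx_adj; exists x^*, y^*.
- move=> N Nl; exists (N 0 0), (N 1 1); apply: dmxP; apply: normc_lt_eq0 => e e0;
    have [_ [x [y ->]] MN] := Nl e e0.
  + by have := MN 0 1; rewrite mxE /= sub0r normcN.
  + by have := MN 1 0; rewrite mxE /= sub0r normcN.
Defined.

Definition scalar_ms : mx_star.
Proof.
exists (fun M => exists x, M = dmx x x).
- by exists 1; rewrite dmx1.
- by move=> M N [x ->] [z ->]; rewrite dmxD; exists (x + z).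
- by move=> c M [x ->]; rewrite dmxZ; exists (c * x).
- by move=> M N [x ->] [z ->]; rewrite dmxM; exists (x * z).
- by move=> M [x ->]; rewrite dmx_adj; exists x^*.
- move=> N Nl.
  (* A limit of scalar matrices is diagonal by the previous case; it remains to compare its two
     entries. *)
  have [x [y Nxy]] : diag_ms N.
    apply: ms_lim => e e0; have [M [x Mx] MN] := Nl e e0.
    by exists M => //; exists x, x.
  exists x; rewrite Nxy; suff -> : x = y by [].
  apply/eqP; rewrite -subr_eq0; apply/eqP; apply: normc_lt_eq0 => e e0.
  have [_ [z ->] MN] := Nl (e / 2) (divr_gt0 e0 (ltr0n _ 2)).
  have := MN 0 0; have := MN 1 1; rewrite Nxy !mxE /= => h k.
  have -> : x - y = (z - y) - (z - x) by ring.
  apply: le_trans (le_normcD _ _) _; rewrite normcN.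
  by move: (normc _) (normc _) h k => u v; lra.
Defined.

(** A copy of [Q] itself. Keeping the line as domain lets all vertices share one type of arrows. *)
Definition const_pred (Q : mx_star) : cstar_pred R R.
Proof.
exists (fun f => Q (f 0) /\ forall t, f t = f 0).
- by split=> //; exact: ms1.
- by move=> f g [Qf fc] [Qg gc]; split=> [|t]; [exact: msD|rewrite fc gc].
- by move=> c f [Qf fc]; split=> [|t]; [exact: msZ|rewrite fc].
- by move=> f g [Qf fc] [Qg gc]; split=> [|t]; [exact: msM|rewrite fc gc].
- by move=> f [Qf fc]; split=> [|t]; [exact: ms_adj|rewrite fc].
- move=> f [_ fc]; exists (\sum_i \sum_j normc (f 0 i j)) => t i j; rewrite fc.
  rewrite (bigD1 i)//= (bigD1 j)//= -addrA lerDl.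
  by rewrite addr_ge0 ?sumr_ge0// => *; rewrite ?sumr_ge0// => *; exact: normc_ge0.
- move=> g gl; split.
    apply: ms_lim => e e0; have [f [Qf _] fg] := gl e e0.
    by exists (f 0) => // i j; exact: fg.
  move=> t; apply/matrixP => i j; apply/eqP; rewrite -subr_eq0; apply/eqP.
  apply: normc_lt_eq0 => e e0.
  have [f [_ fc] fg] := gl (e / 2) (divr_gt0 e0 (ltr0n _ 2)).
  have := fg t i j; have := fg 0 i j; rewrite fc => h k.
  have -> : g t i j - g 0 i j = (f 0 i j - g 0 i j) - (f 0 i j - g t i j) by ring.
  apply: le_trans (le_normcD _ _) _; rewrite normcN.
  by move: (normc _) (normc _) h k => u v; lra.
Defined.

Lemma continuous_uniform_lim (u : R -> R) :
  (forall e : R, 0 < e -> exists2 v : R -> R, continuous v & forall t, `|v t - u t| <= e) ->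
  continuous u.
Proof.
move=> ul t; apply/cvgrPdist_le => e e0.
have e30 : 0 < e / 3 by rewrite divr_gt0.
have [v vc vu] := ul _ e30.
have := vc t => /cvgrPdist_le/(_ _ e30); apply: filterS => s vs.
have h1 := vu s; have h2 := vu t; rewrite distrC in h1.
have -> : u t - u s = (v t - v s) - (v t - u t) - (u s - v s) by ring.
apply: le_trans (ler_normB _ _) _; apply: le_trans (lerD (ler_normB _ _) h1) _.
by move: vs h2; move: `|_| `|_|=> a b; lra.
Qed.

Lemma continuous_clamp_bounded (u : R -> R) : continuous u ->
  (forall t, t <= 0 -> u t = u 0) -> (forall t, 1 <= t -> u t = u 1) ->
  exists c, forall t, u t <= c.
Proof.
move=> uc u0 u1.
have [c _ cP] := @EVT_max R u 0 1 ler01 (continuous_subspaceT uc).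
exists (u c) => t; have [t0|t0] := leP t 0.
  by rewrite u0//; apply: cP; rewrite in_itv /= lexx ler01.
have [t1|t1] := leP 1 t.
  by rewrite u1//; apply: cP; rewrite in_itv /= lexx ler01.
by apply: cP; rewrite in_itv /= !ltW.
Qed.

(* Continuous functions on [0, 1] are encoded as functions on the line which
   are constant on both sides of the interval. *)
Definition path_set (f : R -> 'M[C]_2) :=
  [/\ diag_ms (f 0), mxcont f, forall t, t <= 0 -> f t = f 0 &
    forall t, 1 <= t -> f t = f 1].

Definition path_pred : cstar_pred R R.
Proof.
exists path_set.
- by split=> //; [exact: ms1|exact: mxcont_cst].
- move=> f g [Qf fc f0 f1] [Qg gc g0 g1]; split=> [||t t0|t t1].
  + exact: msD.
  + exact: mxcontD.
  + by rewrite f0// g0.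
  + by rewrite f1// g1.
- move=> c f [Qf fc f0 f1]; split=> [||t t0|t t1].
  + exact: msZ.
  + exact: mxcontZ.
  + by rewrite f0.
  + by rewrite f1.
- move=> f g [Qf fc f0 f1] [Qg gc g0 g1]; split=> [||t t0|t t1].
  + exact: msM.
  + exact: mxcontM.
  + by rewrite f0// g0.
  + by rewrite f1// g1.
- move=> f [Qf fc f0 f1]; split=> [||t t0|t t1].
  + exact: ms_adj.
  + by move=> i j; apply: ccont_eq (ccont_conj (fc j i)) => t; rewrite !mxE.
  + by rewrite f0.
  + by rewrite f1.
- move=> f [_ fc f0 f1].
  have b i j : exists c, forall t, normc (f t i j) <= c.
    have [|||c cP] := @continuous_clamp_bounded (fun t => normc (f t i j) ^+ 2).
    + exact: continuous_normc_sqr.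
    + by move=> t t0; rewrite f0.
    + by move=> t t1; rewrite f1.
    (* The bound [c] is on the squared modulus, and [u <= u ^+ 2 + 1]. *)
    exists (c + 1) => t; have := cP t; move: (normc _) => u uc.
    by have := sqr_ge0 (u - 1); nra.
  exists (\sum_i \sum_j `|projT1 (cid (b i j))|) => t i j.
  apply: le_trans (projT2 (cid (b i j)) t) _; apply: le_trans (ler_norm _) _.
  rewrite (bigD1 i)//= (bigD1 j)//= -addrA lerDl.
  by rewrite addr_ge0 ?sumr_ge0// => *; rewrite ?sumr_ge0.
- move=> g gl.
  (* An equality of values common to all paths passes to uniform limits; this gives the constancy
     outside of the interval. *)
  have eqg s t : (forall f, path_set f -> f s = f t) -> g s = g t.
    move=> st; apply/matrixP => i j; apply/eqP; rewrite -subr_eq0; apply/eqP.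
    apply: normc_lt_eq0 => e e0.
    have [f fP fg] := gl (e / 2) (divr_gt0 e0 (ltr0n _ 2)).
    have := fg s i j; have := fg t i j; rewrite (st f fP) => h k.
    have -> : g s i j - g t i j = (f t i j - g t i j) - (f t i j - g s i j) by ring.
    apply: le_trans (le_normcD _ _) _; rewrite normcN.
    by move: (normc _) (normc _) h k => u v; lra.
  split.
  + apply: ms_lim => e e0; have [f [Qf _ _ _] fg] := gl e e0.
    by exists (f 0) => // i j; exact: fg.
  + move=> i j; split; apply: continuous_uniform_lim => e e0;
      have [f [_ fc _ _] fg] := gl e e0.
    * exists (@complex.Re _ \o (fun t => f t i j)); first exact: (fc i j).1.
      by move=> t /=; rewrite -creB; apply: le_trans (Re_le_normc _) (fg t i j).
    * exists (@complex.Im _ \o (fun t => f t i j)); first exact: (fc i j).2.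
      by move=> t /=; rewrite -cimB; apply: le_trans (Im_le_normc _) (fg t i j).
  + by move=> t t0; apply: eqg => f [_ _ f0 _]; exact: f0.
  + by move=> t t1; apply: eqg => f [_ _ _ f1]; exact: f1.
Defined.

End DiagonalMatrices.

(** * The two diagonal idempotents and standard matrices over a vertex algebra *)

Section Elements.
Variables (R : realType) (T : Type) (P : cstar_pred R T).
Local Notation C := R[i].
Local Notation A := (cring (falg P)).

(* Functions outside of [P] are sent to the junk value [0]. *)
Definition felt (f : T -> 'M[C]_2) : A :=
  if pselect (P f) is left Pf then (Falg Pf : falg P) else 0.

Lemma feltE f t : P f -> (felt f : falg P) t = f t.
Proof. by rewrite /felt; case: pselect. Qed.

Lemma feltM f g : P f -> P g -> felt f * felt g = felt (fun t => f t *m g t).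
Proof.
move=> Pf Pg; apply: falg_eq => t; rewrite feltE; last exact: cpM.
by transitivity ((felt f : falg P) t *m (felt g : falg P) t); [by []|by rewrite !feltE].
Qed.

Lemma felt_idem f : P f -> (forall t, f t *m f t = f t) -> felt f * felt f = felt f.
Proof. by move=> Pf ff; rewrite feltM//; congr felt; apply/funext. Qed.

Lemma V_felt_equiv f g x y : P f -> P g -> P x -> P y ->
  (forall t, f t *m f t = f t) -> (forall t, g t *m g t = g t) ->
  (forall t, f t = x t *m y t) -> (forall t, g t = y t *m x t) ->
  V_elt (felt f) = V_elt (felt g).
Proof.
move=> Pf Pg Px Py ff gg fxy gyx.
apply: (@V_elt_equiv _ _ _ (felt x) (felt y)); rewrite ?felt_idem ?feltM//.
  by congr felt; apply/funext.
by congr felt; apply/funext.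
Qed.

Definition const_dmx x y : T -> 'M[C]_2 := fun=> dmx x y.

Lemma const_dmx_idem x y : x * x = x -> y * y = y ->
  forall t, const_dmx x y t *m const_dmx x y t = const_dmx x y t.
Proof. by move=> xx yy t; rewrite dmxM xx yy. Qed.

Section DiagonalElements.
Hypothesis Pd : forall x y, P (const_dmx x y).

Definition elt1 : A := felt (const_dmx 1 0).
Definition elt2 : A := felt (const_dmx 0 1).

Lemma felt_dmxM x y z w : felt (const_dmx x y) * felt (const_dmx z w) =
  felt (const_dmx (x * z) (y * w)).
Proof. by rewrite feltM//; congr felt; apply/funext => t; rewrite dmxM. Qed.

Lemma elt1M : elt1 * elt1 = elt1.
Proof. by rewrite felt_dmxM mulr1 mulr0. Qed.
Lemma elt2M : elt2 * elt2 = elt2.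
Proof. by rewrite felt_dmxM mulr1 mulr0. Qed.
Lemma felt0 : felt (const_dmx 0 0) = 0.
Proof. by apply: falg_eq => t; rewrite feltE// falg0 /const_dmx dmx0. Qed.
Lemma elt12 : elt1 * elt2 = 0.
Proof. by rewrite felt_dmxM mulr0 mul0r felt0. Qed.
Lemma elt21 : elt2 * elt1 = 0.
Proof. by rewrite felt_dmxM mulr0 mul0r felt0. Qed.

Lemma elt1D2 : elt1 + elt2 = 1.
Proof.
apply: falg_eq => t; rewrite falgD !feltE// dmxD addr0 add0r; exact: dmx1.
Qed.

Lemma V_elt12 : V_elt elt1 + V_elt elt2 = V_unit A.
Proof.
by rewrite -V_elt1 -elt1D2 /V_elt V_smxD ?elt1M ?elt2M ?elt12 ?elt21.
Qed.

End DiagonalElements.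

Lemma cell_block n (D1 D2 : 'M[C]_n) i j :
  cell (block_mx D1 0 0 D2) i j = dmx (D1 i j) (D2 i j).
Proof.
by apply: mx2P; rewrite [LHS]mxE [RHS]mxE /blk_ord /= ?block_mxEul ?block_mxEur
  ?block_mxEdl ?block_mxEdr ?mxE.
Qed.

(** Such an [M] is the sum of the orthogonal idempotents [smx elt1 r1] and [smx elt2 r2]. *)
Lemma V_class_std n r1 r2 (M : 'M[A]_n) (MM : M *m M = M) :
  (forall x y, P (const_dmx x y)) ->
  (r1 <= n)%N -> (r2 <= n)%N ->
  (forall t, blk M t = block_mx (pid_mx r1) 0 0 (pid_mx r2)) ->
  V_class (idem_of_mx MM) = V_elt elt1 *+ r1 + V_elt elt2 *+ r2.
Proof.
move=> Pd r1n r2n ME.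
rewrite -!V_smx_nat ?elt1M ?elt2M//.
rewrite -(V_class_smx r1 (elt1M Pd)) -(V_class_smx r2 (elt2M Pd)); symmetry.
apply: V_addE_orth.
- by rewrite [LHS]smxM elt12// smx0.
- by rewrite [LHS]smxM elt21// smx0.
apply: MinfP => i j /=; rewrite /mx_entry.
have out r (e : A) : (r <= n)%N -> (n <= i)%N || (n <= j)%N ->
    (if (i == j) && (i < r)%N then e else 0) = 0.
  move=> rn h; case: eqP => //= ij; case: ltnP => // ir; subst j.
  by rewrite orbb leqNgt (leq_trans ir rn) in h.
case: insubP => [i' _ ii|]; last first.
  by rewrite -leqNgt => ni; rewrite !out ?ni// addr0.
case: insubP => [j' _ jj|]; last first.
  by rewrite -leqNgt => nj; rewrite !out ?nj ?orbT// addr0.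
rewrite -ii -jj; apply: falg_eq => t.
rewrite -(cell_blk M t) ME cell_block !mxE falgD /=.
have ifE (b : bool) (e : A) : ((if b then e else 0 : A) : falg P) t =
    if b then (e : falg P) t else 0.
  by case: b => //; exact: falg0.
rewrite !ifE !feltE// /const_dmx.
by case: (_ && _); case: (_ && _); rewrite ?dmxD ?addr0 ?add0r ?dmx0.
Qed.

Lemma V_class_std1 n r (M : 'M[A]_n) (MM : M *m M = M) : (r <= n)%N ->
  (forall t, blk M t = block_mx (pid_mx r) 0 0 (pid_mx r)) ->
  V_class (idem_of_mx MM) = V_unit A *+ r.
Proof.
move=> rn ME; rewrite -V_elt1 -V_smx_nat ?mulr1//; apply: V_smxE; first exact: mulr1.
apply: MinfP => i j /=; rewrite /mx_entry.
have out : (n <= i)%N || (n <= j)%N ->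
    0 = (if (i == j) && (i < r)%N then 1 else 0 : A).
  move=> h; case: eqP => //= ij; case: ltnP => // ir; subst j.
  by rewrite orbb leqNgt (leq_trans ir rn) in h.
case: insubP => [i' _ ii|]; last by rewrite -leqNgt => ni; apply: out; rewrite ni.
case: insubP => [j' _ jj|]; last first.
  by rewrite -leqNgt => nj; apply: out; rewrite nj orbT.
rewrite -ii -jj; apply: falg_eq => t.
rewrite -(cell_blk M t) ME cell_block !mxE /=.
case: (_ && _); first exact: dmx1.
by rewrite dmx0; symmetry; exact: falg0.
Qed.

(** Pointwise factorisations give an equivalence over the algebra as soon as the cells of both
    factors belong to [P]. *)
Lemma V_class_blk n (M : 'M[A]_n) (MM : M *m M = M) (X Y : T -> 'M[C]_(n + n)) :
  (forall i j, P (fun t => cell (X t) i j)) ->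
  (forall i j, P (fun t => cell (Y t) i j)) ->
  (forall t, blk M t = X t *m Y t) ->
  (forall t, (Y t *m X t) *m (Y t *m X t) = Y t *m X t) ->
  exists N (NN : N *m N = N), (forall t, blk N t = Y t *m X t) /\
    V_class (idem_of_mx MM) = V_class (idem_of_mx NN).
Proof.
move=> /blk_ex[X' X'E] /blk_ex[Y' Y'E] ME YX.
have NE t : blk (Y' *m X') t = Y t *m X t by rewrite blkM X'E Y'E.
have NN : (Y' *m X') *m (Y' *m X') = Y' *m X'.
  by apply: blk_inj => t; rewrite blkM NE YX.
exists (Y' *m X'), NN; split=> //; apply/V_classP.
apply: (@idem_equiv_mx _ _ _ _ X' Y') => //.
by apply: blk_inj => t; rewrite ME blkM X'E Y'E.
Qed.


End Elements.

(** * Idempotents of the vertex algebras *)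

Section Surjectivity.
Variable R : realType.
Local Notation C := R[i].

Lemma block_diag_mul n (D1 D2 E1 E2 : 'M[C]_n) :
  block_mx D1 0 0 D2 *m block_mx E1 0 0 E2 = block_mx (D1 *m E1) 0 0 (D2 *m E2).
Proof. by rewrite mulmx_block !mul0mx !mulmx0 !addr0 !add0r. Qed.

Lemma block_diag_idem n (D1 D2 : 'M[C]_n) :
  block_mx D1 0 0 D2 *m block_mx D1 0 0 D2 = block_mx D1 0 0 D2 ->
  D1 *m D1 = D1 /\ D2 *m D2 = D2.
Proof. by rewrite block_diag_mul => /eq_block_mx[-> _ _ ->]. Qed.

Lemma cell_diag n (Z : 'M[C]_(n + n)) :
  (forall i j, diag_ms R (cell Z i j)) -> Z = block_mx (ulsubmx Z) 0 0 (drsubmx Z).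
Proof.
move=> Zd; apply: cell_inj => i j; rewrite cell_block.
have [x [y xy]] := Zd i j; rewrite xy.
have e r s : cell Z i j r s = dmx x y r s by rewrite xy.
by have := e 0 0; have := e 1 1; rewrite !mxE /blk_ord /= => -> ->.
Qed.


End Surjectivity.

Section ConstantDiagonal.
Variables (R : realType) (P : cstar_pred R R).
Local Notation C := R[i].
Local Notation A := (cring (falg P)).
Hypothesis Pd : forall x y, P (const_dmx x y).

(** The two blocks are complex idempotents, each brought to a partial identity by constant block
    diagonal factors. This covers the diagonal algebra, and the path algebra once paths are
    contracted to their starting points. *)
Lemma V_class_const_diag n (M : 'M[A]_n) (MM : M *m M = M) (D1 D2 : 'M[C]_n) :
  (forall t, blk M t = block_mx D1 0 0 D2) ->
  exists r1 r2, V_class (idem_of_mx MM) = V_elt (elt1 P) *+ r1 + V_elt (elt2 P) *+ r2.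
Proof.
move=> ME.
have [D11 D22] : D1 *m D1 = D1 /\ D2 *m D2 = D2.
  by apply: block_diag_idem; rewrite -(ME 0) -blkM MM.
have [r1 [X1 [Y1 [DX1 YX1 r1n]]]] := idem_mx_equiv_pid D11.
have [r2 [X2 [Y2 [DX2 YX2 r2n]]]] := idem_mx_equiv_pid D22.
have [||t|t|N [NN [NE ->]]] := @V_class_blk _ _ _ _ M MM
  (fun=> block_mx X1 0 0 X2) (fun=> block_mx Y1 0 0 Y2).
- move=> i j; rewrite (_ : (fun=> _) = const_dmx (X1 i j) (X2 i j)); first exact: Pd.
  by apply/funext => t; rewrite cell_block.
- move=> i j; rewrite (_ : (fun=> _) = const_dmx (Y1 i j) (Y2 i j)); first exact: Pd.
  by apply/funext => t; rewrite cell_block.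
- by rewrite ME block_diag_mul -DX1 -DX2.
- by rewrite !block_diag_mul -YX1 -YX2 !pid_mx_id.
exists r1, r2; apply: V_class_std => // t.
by rewrite NE block_diag_mul YX1 YX2.
Qed.

End ConstantDiagonal.

Section ConstantAlgebras.
Variable R : realType.
Local Notation C := R[i].

Lemma blk_const (Q : mx_star R) n (M : 'M[cring (falg (const_pred Q))]_n) t :
  blk M t = blk M 0.
Proof.
by apply: cell_inj => i j; rewrite !cell_blk; have [_ ->] := falgP (M i j).
Qed.

Lemma V_scalar_surj (u : V (cring (falg (const_pred (scalar_ms R))))) :
  exists r, u = V_unit _ *+ r.
Proof.
have [n [M [MM ->]]] := V_ex_mx u.
pose D : 'M[C]_n := \matrix_(i, j) (M i j : falg _) 0 0 0.
have ME t : blk M t = block_mx D 0 0 D.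
  rewrite blk_const; apply: cell_inj => i j; rewrite cell_blk cell_block mxE.
  by have [[x ->] _] := falgP (M i j); rewrite mxE.
have [DD _] : D *m D = D /\ D *m D = D.
  by apply: block_diag_idem; rewrite -(ME 0) -blkM MM.
have [r [X [Y [DXY pYX rn]]]] := idem_mx_equiv_pid DD.
have sc (E : 'M[C]_n) i j :
    const_pred (scalar_ms R) (fun=> cell (block_mx E 0 0 E) i j).
  by split=> //; rewrite cell_block; exists (E i j).
have [||t|t|N [NN [NE ->]]] := @V_class_blk _ _ _ _ M MM
  (fun=> block_mx X 0 0 X) (fun=> block_mx Y 0 0 Y).
- exact: sc.
- exact: sc.
- by rewrite ME block_diag_mul -DXY.
- by rewrite !block_diag_mul -pYX !pid_mx_id.
exists r; apply: V_class_std1 => // t.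
by rewrite NE block_diag_mul pYX.
Qed.

Lemma diag_const_dmx x y : const_pred (diag_ms R) (const_dmx x y).
Proof. by split=> //; exists x, y. Qed.

Lemma full_const_dmx x y : const_pred (full_ms R) (const_dmx x y).
Proof. by []. Qed.

Lemma V_diag_surj (u : V (cring (falg (const_pred (diag_ms R))))) :
  exists r1 r2, u = V_elt (elt1 _) *+ r1 + V_elt (elt2 _) *+ r2.
Proof.
have [n [M [MM ->]]] := V_ex_mx u.
apply: (V_class_const_diag diag_const_dmx) => t.
rewrite blk_const; apply: cell_diag => i j; rewrite cell_blk.
by have [] := falgP (M i j).
Qed.

Lemma V_full_elt12 : V_elt (elt1 (const_pred (full_ms R))) = V_elt (elt2 _).
Proof.
apply: (@V_felt_equiv _ _ _ _ _ (fun=> delta_mx 0 1) (fun=> delta_mx 1 0)) => //.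
- by apply: const_dmx_idem; rewrite ?mulr1 ?mulr0.
- by apply: const_dmx_idem; rewrite ?mulr1 ?mulr0.
- by move=> t; rewrite mul_delta_mx; apply: mx2P; rewrite !mxE.
- by move=> t; rewrite mul_delta_mx; apply: mx2P; rewrite !mxE.
Qed.

Lemma pid_mx_double n r : (pid_mx r : 'M[C]_(n + n)) =
  block_mx (pid_mx (minn r n)) 0 0 (pid_mx (r - n)).
Proof.
apply/matrixP => k l; rewrite -[k]fintype.splitK -[l]fintype.splitK.
case: (fintype.split k) => i; case: (fintype.split l) => j /=.
- by rewrite block_mxEul !mxE /= leq_min ltn_ord andbT.
- rewrite block_mxEur !mxE /=; case: eqP => // ij.
  by have := ltn_ord i; rewrite ij ltnNge leq_addr.
- rewrite block_mxEdl !mxE /=; case: eqP => // ij.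
  by have := ltn_ord j; rewrite -ij ltnNge leq_addr.
- by rewrite block_mxEdr !mxE /= eqn_add2l -ltn_subRL.
Qed.

Lemma V_full_surj (u : V (cring (falg (const_pred (full_ms R))))) :
  exists r, u = V_elt (elt1 _) *+ r.
Proof.
have [n [M [MM ->]]] := V_ex_mx u.
have ZZ : blk M 0 *m blk M 0 = blk M 0 by rewrite -blkM MM.
have [r [X [Y [ZXY pYX rn]]]] := idem_mx_equiv_pid ZZ.
have [||t|t|N [NN [NE ->]]] := @V_class_blk _ _ _ _ M MM (fun=> X) (fun=> Y) => //.
- by rewrite blk_const.
- by rewrite -pYX pid_mx_id.
(* A partial identity of rank [r] and size [2n] fills the first block, then the second; the
   truncated difference [r - n] is 0 when the first block suffices. *)
exists (minn r n + (r - n))%N; rewrite mulrnDr {2}V_full_elt12.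
apply: (V_class_std NN full_const_dmx); [exact: geq_minr|by rewrite leq_subLR|].
by move=> t; rewrite NE -pid_mx_double.
Qed.

End ConstantAlgebras.

(** * Contracting idempotents over the path algebra *)

Section PathAlgebra.
Variable R : realType.
Local Notation C := R[i].
Local Notation B := (falg (path_pred R)).
Local Notation A := (cring B).

Lemma path_const_dmx x y : path_pred R (const_dmx x y).
Proof. by split=> //; [exists x, y|exact: mxcont_cst]. Qed.

(** The path stopped at time [s]: it is [f] for [s = 1] and the constant [f 0] for [s = 0]. *)
Lemma path_min (f : R -> 'M[C]_2) s :
  path_pred R f -> path_pred R (fun t => f (Num.min s t)).
Proof.
move=> [Qf fc f0 f1].
have fm t : t <= 0 -> f (Num.min s t) = f 0.
  by move=> t0; apply: f0; rewrite ge_min t0 orbT.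
split=> [||t t0|t t1].
- by rewrite fm.
- apply: (@mxcont_comp _ _ _ _ _ (Num.min s) f) fc => t.
  by apply: continuous_min; [exact: cvg_cst|exact: cvg_id].
- by rewrite !fm.
- have [s1|s1] := leP 1 s.
    by rewrite f1// le_min s1.
  by rewrite (min_l (ltW (lt_le_trans s1 t1))).
Qed.

Definition mx_min n s (M : 'M[A]_n) : 'M[A]_n :=
  \matrix_(i, j) (Falg (path_min s (falgP (M i j))) : B).

Lemma blk_min n s (M : 'M[A]_n) t : blk (mx_min s M) t = blk M (Num.min s t).
Proof. by apply: cell_inj => i j; rewrite !cell_blk mxE. Qed.

Lemma mx_min_idem n s (M : 'M[A]_n) : M *m M = M ->
  mx_min s M *m mx_min s M = mx_min s M.
Proof. by move=> MM; apply: blk_inj => t; rewrite blkM blk_min -blkM MM. Qed.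

Lemma blk_cont n (M : 'M[A]_n) : mxcont (blk M).
Proof.
move=> k l; have [r [i ->]] := ord_blkP k; have [s [j ->]] := ord_blkP l.
have [_ fc _ _] := falgP (M i j).
by apply: ccont_eq (fc r s) => t; rewrite blkE.
Qed.

(* [W := E F + (1 - E) (1 - F)] is the identity where [E = F], and [E W = W F]. *)
Lemma idem_equiv_close n (E F : 'M[A]_n) : E *m E = E -> F *m F = F ->
  blk E 0 = blk F 0 ->
  (forall t, blk (E *m F + (1%:M - E) *m (1%:M - F)) t \in unitmx) ->
  idem_equiv (Minf_of_mx E) (Minf_of_mx F).
Proof.
move=> EE FF EF0 Wu; have [EW WF] := idem_intertwine EE FF.
set W := _ + _ in EW WF Wu.
have W0 : blk W 0 = 1%:M.
  have : blk E 0 *m blk E 0 = blk E 0 by rewrite -blkM EE.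
  rewrite /W blk_intertwiner -EF0; move: (blk E 0) => Z ZZ.
  by rewrite mulmxBl mul1mx mulmxBr mulmx1 ZZ subrr subr0 addrCA subrr addr0.
have blkc (M : 'M[A]_n) s t : (forall f, path_set f -> f s = f t) -> blk M s = blk M t.
  by move=> st; apply: cell_inj => i j; rewrite !cell_blk; exact: (st _ (falgP (M i j))).
(* The pointwise inverse has cells in the path algebra: it is continuous, and at [0] it is the
   identity, whose cells are diagonal. This is where the equality of [E] and [F] at [0] enters. *)
have [|U UE] := @blk_ex _ _ (path_pred R) n (fun t => invmx (blk W t)).
  move=> i j; split=> [||t t0|t t1].
  - rewrite W0 invmx1 -(blk1 (path_pred R) _ 0) cell_blk.
    by have [] := falgP ((1%:M : 'M[A]_n) i j).
  - move=> r s; apply: ccont_eq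
      (mxcont_inv Wu (@blk_cont _ W) (blk_ord r i) (blk_ord s j)) => t.
    by rewrite mxE.
  - by rewrite (blkc W t 0)// => f [_ _ f0 _]; exact: f0.
  - by rewrite (blkc W t 1)// => f [_ _ _ f1]; exact: f1.
have UW : U *m W = 1%:M by apply: blk_inj => t; rewrite blkM UE mulVmx ?blk1.
have WU : W *m U = 1%:M by apply: blk_inj => t; rewrite blkM UE mulmxV ?blk1.
apply: (@idem_equiv_mx _ _ _ _ (E *m F) (U *m E)).
  by rewrite -EW -mulmxA (mulmxA W) WU mul1mx EE.
by rewrite -mulmxA (mulmxA E) EE -WF mulmxA UW mul1mx.
Qed.

(** The intertwiner of [Z a] and [Z b] is continuous in [(a, b)] and is the identity at [(s0, s0)],
    so it is invertible nearby. At any time the paths stopped at [s] and [s0] either agree or take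
    values of [Z] at two parameters between [s] and [s0]. *)
Lemma V_mx_min_locally_constant n (M : 'M[A]_n) (MM : M *m M = M) (s0 : R) :
  \forall s \near s0, V_class (idem_of_mx (mx_min_idem s MM)) =
    V_class (idem_of_mx (mx_min_idem s0 MM)).
Proof.
pose Z := blk M.
have Zc : mxcont Z := @blk_cont _ M.
have ZZ t : Z t *m Z t = Z t by rewrite -blkM MM.
pose W (p : R * R) := Z p.1 *m Z p.2 + (1%:M - Z p.1) *m (1%:M - Z p.2).
have Wt t : W (t, t) = 1%:M.
  rewrite /W /= mulmxBl mul1mx mulmxBr mulmx1 ZZ subrr subr0.
  by rewrite addrCA subrr addr0.
have Wc : mxcont W.
  have Z1 : mxcont (fun p : R * R => Z p.1) by apply: mxcont_comp Zc => p; exact: cvg_fst.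
  have Z2 : mxcont (fun p : R * R => Z p.2) by apply: mxcont_comp Zc => p; exact: cvg_snd.
  by apply: mxcontD; apply: mxcontM => //; apply: mxcontB => //; exact: mxcont_cst.
have /(_ (s0, s0)) := continuous_normc_sqr (mxcont_det Wc).
rewrite /continuous_at Wt det1 normc1 expr1n => /cvgr_gt/(_ 0 ltr01).
case=> -[U V] /= [/nbhs_ballP[d1 d1p B1] /nbhs_ballP[d2 d2p B2]] UV.
pose d := Num.min d1 d2.
have dp : 0 < d by rewrite lt_min d1p.
have Wu a b : `|s0 - a| < d -> `|s0 - b| < d -> W (a, b) \in unitmx.
  rewrite !lt_min => /andP[a1 _] /andP[_ b2].
  have /UV /= : (U `*` V)%classic (a, b).
    by split => /=; [apply: B1|apply: B2]; rewrite -ball_normE.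
  rewrite unitmxE unitfE; apply: contraTneq => ->.
  by rewrite normc0 expr0n /= ltxx.
near=> s; apply/V_classP; apply: idem_equiv_close.
- exact: mx_min_idem.
- exact: mx_min_idem.
- apply: cell_inj => i j; rewrite !cell_blk !mxE /=.
  have [_ _ f0 _] := falgP (M i j).
  have f0m u : ((M i j : B) : R -> _) (Num.min u 0) = (M i j : B) 0.
    by apply: f0; rewrite ge_min lexx orbT.
  by rewrite !f0m.
move=> t; rewrite blk_intertwiner !blk_min -/Z.
rewrite -[X in X \in _]/(W (Num.min s t, Num.min s0 t)).
have sd : `|s0 - s| < d by near: s; apply/nbhs_ballP; exists d => //= x; rewrite -ball_normE.
(* The stopped parameters are [(t, t)], [(t, s0)], [(s, t)] and [(s, s0)] respectively. *)
have [ts|st] := leP t s; have [ts0|s0t] := leP t s0.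
- by rewrite Wt unitmx1.
- apply: Wu; last by rewrite subrr normr0.
  by move: sd; rewrite !ltr_norml; lra.
- apply: Wu => //.
  by move: sd; rewrite !ltr_norml; lra.
- by apply: Wu; rewrite ?subrr ?normr0.
Unshelve. all: by end_near. Qed.

Lemma V_path_surj (u : V A) :
  exists r1 r2, u = V_elt (elt1 _) *+ r1 + V_elt (elt2 _) *+ r2.
Proof.
have [n [M [MM ->]]] := V_ex_mx u.
have e := locally_constant (V_mx_min_locally_constant MM) 1.
have M1 : mx_min 1 M = M.
  apply: blk_inj => t; rewrite blk_min; apply: cell_inj => i j; rewrite !cell_blk.
  have [_ _ _ f1] := falgP (M i j).
  by have [t1|//] := leP 1 t; rewrite (f1 t).
have -> : V_class (idem_of_mx MM) = V_class (idem_of_mx (mx_min_idem 0 MM)).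
  by rewrite -e; congr V_class; apply: idem_inj; rewrite /= M1.
apply: (V_class_const_diag path_const_dmx) => t.
rewrite blk_min (_ : blk M _ = blk M 0); first last.
  apply: cell_inj => i j; rewrite !cell_blk.
  have [_ _ f0 _] := falgP (M i j).
  by rewrite (f0 (Num.min 0 t))// ge_min lexx.
apply: cell_diag => i j; rewrite cell_blk.
by have [] := falgP (M i j).
Qed.

End PathAlgebra.

(** * Separating classes by traces *)

Section Injectivity.
Variables (R : realType) (P : cstar_pred R R).
Local Notation C := R[i].
Local Notation A := (cring (falg P)).
Hypothesis Pd : forall x y, P (const_dmx x y).

(** Diagonal matrices commute, so both diagonal entries at [0] are traces on the algebra; they read
    off the two coordinates. *)
Lemma V_elt12_inj (Pdiag : forall f, P f -> diag_ms R (f 0)) :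
  injective (fun x : nat * nat => V_elt (elt1 P) *+ x.1 + V_elt (elt2 P) *+ x.2).
Proof.
pose tau r (f : A) : C := (f : falg P) 0 r r.
have tauD r : {morph tau r : x y / x + y} by move=> f g; rewrite /tau falgD mxE.
have tauC r (f g : A) : tau r (f * g) = tau r (g * f).
  have [x [y fE]] := Pdiag _ (falgP f); have [z [w gE]] := Pdiag _ (falgP g).
  change (((f : falg P) 0 *m (g : falg P) 0) r r = ((g : falg P) 0 *m (f : falg P) 0) r r).
  by rewrite fE gE !dmxM [z * x]mulrC [w * y]mulrC.
have E r x : V_trace (tau r) (V_elt (elt1 P) *+ x.1 + V_elt (elt2 P) *+ x.2) =
    (if r == 0 then x.1 else x.2)%:R.
  rewrite V_traceD// !V_traceMn// !V_trace_elt ?elt1M ?elt2M//.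
  rewrite /tau !feltE// /const_dmx !mxE eqxx.
  by case: ifP => _; rewrite mul0rn ?addr0 ?add0r.
move=> x y xy; have := E 0 x; have := E 1 x; rewrite /= in xy.
rewrite xy !E /= => /eqP + /eqP; rewrite !eqr_nat => /eqP + /eqP.
by case: x y {xy} => [? ?] [? ?] /= -> ->.
Qed.

Lemma V_elt1_inj : injective (fun n => V_elt (elt1 P) *+ n).
Proof.
pose tau (f : A) : C := \tr ((f : falg P) 0).
have tauD : {morph tau : x y / x + y} by move=> f g; rewrite /tau falgD raddfD.
have tauC (f g : A) : tau (f * g) = tau (g * f).
  exact: (mxtrace_mulC ((f : falg P) 0) ((g : falg P) 0)).
have E n : V_trace tau (V_elt (elt1 P) *+ n) = n%:R.
  rewrite V_traceMn// V_trace_elt ?elt1M// /tau feltE// /mxtrace.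
  by rewrite !big_ord_recl big_ord0 !mxE /= !addr0.
move=> m n mn; rewrite /= in mn; have := E m; rewrite mn E => /eqP.
by rewrite eqr_nat => /eqP.
Qed.

End Injectivity.

Lemma V_unit_inj (R : realType) :
  injective (fun n => V_unit (cring (falg (const_pred (scalar_ms R)))) *+ n).
Proof.
set A := cring _.
pose tau (f : A) : R[i] := (f : falg _) 0 0 0.
have tauD : {morph tau : x y / x + y} by move=> f g; rewrite /tau falgD mxE.
have tauC (f g : A) : tau (f * g) = tau (g * f).
  have [[x fE] _] := falgP f; have [[y gE] _] := falgP g.
  change (((f : falg _) 0 *m (g : falg _) 0) 0 0 = ((g : falg _) 0 *m (f : falg _) 0) 0 0).
  by rewrite fE gE !dmxM mulrC.
have E n : V_trace tau (V_unit A *+ n) = n%:R.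
  rewrite -V_elt1 V_traceMn// V_trace_elt ?mulr1//.
  by rewrite (_ : tau 1 = 1) // /tau /= mxE.
move=> m n mn; rewrite /= in mn; have := E m; rewrite mn E => /eqP.
by rewrite eqr_nat => /eqP.
Qed.

(** * A path of rotations from the quarter turn to the identity *)

Section Rotation.
Variable R : realType.
Local Notation C := R[i].

Definition clamp (t : R) : R := Num.max 0 (Num.min 1 t).

(** The circle is parametrised by the cosine, [clamp t], with this as the sine; no trigonometric
    function occurs. *)
Definition rot_sin (t : R) : R := Num.sqrt (1 - clamp t ^+ 2).

Definition rot (t : R) : 'M[C]_2 := \matrix_(r, s)
  if r == s then (clamp t)%:C%C else
  if r == 0 then (- rot_sin t)%:C%C else (rot_sin t)%:C%C.

Lemma clamp_le0 t : t <= 0 -> clamp t = 0.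
Proof. by move=> t0; rewrite /clamp min_r ?(le_trans t0)// max_l. Qed.

Lemma clamp_ge1 t : 1 <= t -> clamp t = 1.
Proof. by move=> t1; rewrite /clamp min_l// max_r. Qed.

Lemma clamp_sqr t : clamp t ^+ 2 + rot_sin t ^+ 2 = 1.
Proof.
have c0 : 0 <= clamp t by rewrite le_max lexx.
have c1 : clamp t <= 1 by rewrite ge_max ler01 ge_min lexx.
rewrite /rot_sin; move: (clamp t) c0 c1 => c c0 c1.
by rewrite (@sqr_sqrtr _ (1 - c ^+ 2)) ?subr_ge0 ?expr_le1// addrC subrK.
Qed.

Lemma adj_rot t : adjm (rot t) = (rot t)^T.
Proof.
by apply: mx2P; rewrite !mxE /=; [exact: conjc_real..].
Qed.

Lemma rotV t : adjm (rot t) *m rot t = 1%:M.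
Proof.
by rewrite adj_rot; apply: mx2P; rewrite mul2E !mxE /= -!rmorphM -rmorphD /=
  -?expr2 ?sqrrN ?[rot_sin t ^+ 2 + _]addrC ?clamp_sqr ?mulrN ?mulNr
  ?[rot_sin t * _]mulrC ?addrN ?addNr.
Qed.

Lemma rot_unitary t : rot t *m adjm (rot t) = 1%:M.
Proof. exact: mulmx1C (rotV t). Qed.

Lemma rot1 : rot 1 = 1%:M.
Proof.
have c1 : clamp 1 = 1 by exact: clamp_ge1.
have s1 : rot_sin 1 = 0 by rewrite /rot_sin c1 expr1n subrr sqrtr0.
by apply: mx2P; rewrite !mxE /= ?c1 ?s1 ?oppr0.
Qed.

Lemma rot_cont : mxcont rot.
Proof.
have cc : continuous clamp.
  move=> t; apply: continuous_max; first exact: cvg_cst.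
  by apply: continuous_min; [exact: cvg_cst|exact: cvg_id].
have sc : continuous rot_sin.
  move=> t; apply: (@continuous_comp _ _ _ (fun t => 1 - clamp t ^+ 2) Num.sqrt);
    last exact: sqrt_continuous.
  by apply: cvgB; [exact: cvg_cst|apply: cvgM; exact: cc].
move=> r s; case: (eqVneq r s) => [<-|rs].
  by apply: ccont_eq (ccont_real cc) => t; rewrite mxE eqxx.
case: (eqVneq r 0) => r0.
  apply: ccont_eq (@ccont_real _ _ (fun t => - rot_sin t) _) => [t|t].
    by rewrite mxE (negPf rs) r0.
  by apply: cvgN; exact: sc.
by apply: ccont_eq (ccont_real sc) => t; rewrite mxE (negPf rs) (negPf r0).
Qed.

Lemma rot_le0 t : t <= 0 -> rot t = rot 0.
Proof. by move=> t0; apply/matrixP => r s; rewrite !mxE /rot_sin !clamp_le0. Qed.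

Lemma rot_ge1 t : 1 <= t -> rot t = rot 1.
Proof. by move=> t1; apply/matrixP => r s; rewrite !mxE /rot_sin !clamp_ge1. Qed.

Lemma rot0 : rot 0 0 0 = 0 /\ rot 0 1 1 = 0.
Proof. by rewrite !mxE /= clamp_le0. Qed.

End Rotation.

(** * The diagram *)

Section Twist.
Variables (R : realType) (T : Type).
Local Notation C := R[i].

(** The common form of all arrows: inclusions have [u = 1] and [g = id], evaluation at [1] has [g]
    constant, and the arrow from [A_1] to [B_2] has [u] the path of rotations. *)
Definition twist (u : T -> 'M[C]_2) (g : T -> T) (f : T -> 'M[C]_2) t :=
  u t *m f (g t) *m adjm (u t).

Variables (P Q : cstar_pred R T) (u : T -> 'M[C]_2) (g : T -> T).
Hypothesis u_unitary : forall t, adjm (u t) *m u t = 1%:M.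
Hypothesis PQ : forall f, P f -> Q (twist u g f).

Definition twist_fun (f : falg P) : falg Q := Falg (PQ (falgP f)).

Lemma twist_linear : linear twist_fun.
Proof.
move=> c f h; apply: falg_eq => t.
change (twist u g (c *: f + h) t = c *: twist u g f t + twist u g h t).
by rewrite /twist falgD falgZ mulmxDr mulmxDl -scalemxAr -scalemxAl.
Qed.

Lemma twist_mul : {morph twist_fun : f h / cmul f h}.
Proof.
move=> f h; apply: falg_eq => t.
by rewrite /= /twist !mulmxA -(mulmxA _ (adjm (u t))) u_unitary mulmx1.
Qed.

Lemma twist_one : twist_fun cone = cone.
Proof. by apply: falg_eq => t; rewrite /= /twist mulmx1 (mulmx1C (u_unitary t)). Qed.

Lemma twist_star : {morph twist_fun : f / star f}.
Proof. by move=> f; apply: falg_eq => t; rewrite /= /twist !adjmM adjmK mulmxA. Qed.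

Definition twist_hom : cstar_hom (falg P) (falg Q) :=
  CStarHom twist_linear twist_mul twist_one twist_star.

Lemma V_twist_felt f : P f -> (forall t, f t *m f t = f t) ->
  V_map (cring_hom twist_hom) (V_elt (felt P f)) = V_elt (felt Q (twist u g f)).
Proof.
move=> Pf ff; rewrite (V_map_elt (cring_hom twist_hom)); last exact: felt_idem.
congr V_elt; apply: falg_eq => t; rewrite feltE; last exact: PQ.
by rewrite /= /twist feltE.
Qed.

End Twist.

(** * The lifted cube and its comparison with the diagram of monoids *)

Section CubeDiagram.
Variable R : realType.
Local Notation C := R[i].

Implicit Types p q r : cube.

Definition vertex (p : cube) : cstar_pred R R :=
  match p with
  | vA => const_pred (scalar_ms R)
  | vB => const_pred (full_ms R)
  | vB2 => path_pred R
  | _ => const_pred (diag_ms R)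
  end.

Definition arrow_mx (p q : cube) : R -> 'M[C]_2 :=
  if (p == vA1) && (q == vB2) then @rot R else fun=> 1%:M.

(** Evaluation at [1] is used for every arrow into [vB]; on constant functions it is the
    inclusion. *)
Definition arrow_arg (q : cube) : R -> R := if q == vB then fun=> 1 else id.

Definition arrow (p q : cube) := twist (arrow_mx p q) (arrow_arg q).

Lemma arrow_unitary p q t : adjm (arrow_mx p q t) *m arrow_mx p q t = 1%:M.
Proof.
have h : adjm (1%:M : 'M[C]_2) *m 1%:M = 1%:M by rewrite adjm1 mulmx1.
by rewrite /arrow_mx; case: ifP => _; [exact: rotV|exact: h].
Qed.

Lemma twist1 (g : R -> R) f : twist (fun=> 1%:M) g f = (fun t => f (g t)) :> (R -> 'M[C]_2).
Proof. by apply/funext => t; rewrite /twist adjm1 mul1mx mulmx1. Qed.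

Lemma arrow_vB p f : arrow p vB f = fun=> f 1.
Proof. by rewrite /arrow /arrow_mx /arrow_arg andbF twist1. Qed.

Lemma arrow_vA1_vB2 f : arrow vA1 vB2 f = twist (@rot R) id f.
Proof. by []. Qed.

Lemma arrow_incl p q f : q != vB -> ~~ ((p == vA1) && (q == vB2)) -> arrow p q f = f.
Proof. by move=> /negPf qB /negPf pq; rewrite /arrow /arrow_mx /arrow_arg qB pq twist1. Qed.

Lemma scalar_dmx f : const_pred (scalar_ms R) f -> exists x, f = const_dmx x x.
Proof. by move=> [[x f0] fc]; exists x; apply/funext => t; rewrite fc. Qed.

Lemma diag_dmx f : const_pred (diag_ms R) f -> exists x y, f = const_dmx x y.
Proof. by move=> [[x [y f0]] fc]; exists x, y; apply/funext => t; rewrite fc. Qed.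

(** At [0] the quarter turn exchanges the two axes, so conjugation by it keeps diagonal matrices
    diagonal. *)
Lemma twist_rot_path x y : path_pred R (twist (@rot R) id (const_dmx x y)).
Proof.
split=> [||t t0|t t1].
- have [r0 r1] := rot0 R.
  exists (twist (@rot R) id (const_dmx x y) 0 0 0).
  exists (twist (@rot R) id (const_dmx x y) 0 1 1).
  by apply: dmxP; rewrite /twist /const_dmx !mul2E adj_rot !mxE /= clamp_le0//
    !(mulr0, mul0r, addr0).
- apply: mxcontM; first by apply: mxcontM; [exact: rot_cont|exact: mxcont_cst].
  move=> i j; apply: ccont_eq (rot_cont R j i) => t.
  by rewrite adj_rot [RHS]mxE.
- by rewrite /twist rot_le0.
- by rewrite /twist rot_ge1.
Qed.

Lemma vertex_incl p q : (p <= q)%O -> q != vB -> forall f, vertex p f -> vertex q f.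
Proof.
have sd f : const_pred (scalar_ms R) f -> const_pred (diag_ms R) f.
  by move=> /scalar_dmx[x ->]; exact: diag_const_dmx.
have dp f : const_pred (diag_ms R) f -> path_pred R f.
  by move=> /diag_dmx[x [y ->]]; exact: path_const_dmx.
by case: p => [[[] []] []]; case: q => [[[] []] []] // _ _ f; rewrite /vertex;
  first [exact: id|exact: sd|exact: dp|move=> /sd/dp].
Qed.

Lemma arrow_vertex p q : (p <= q)%O -> forall f, vertex p f -> vertex q (arrow p q f).
Proof.
move=> pq f pf; have [->|qB] := eqVneq q vB; first by rewrite arrow_vB.
have [/andP[/eqP p1 /eqP q2]|pq'] := boolP ((p == vA1) && (q == vB2)).
  move: pf; rewrite p1 q2 arrow_vA1_vB2 => /diag_dmx[x [y ->]].
  exact: twist_rot_path.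
by rewrite arrow_incl//; exact: vertex_incl pq qB f pf.
Qed.

Definition arrow_hom p q (pq : (p <= q)%O) :
    cstar_hom (falg (vertex p)) (falg (vertex q)) :=
  twist_hom (arrow_unitary p q) (arrow_vertex pq).

Lemma arrow_id p (pp : (p <= p)%O) f : arrow_hom pp f = f.
Proof.
apply: falg_eq => t; change (arrow p p f t = f t).
have [pB|pB] := eqVneq p vB; last first.
  by rewrite arrow_incl//; apply/negP => /andP[/eqP ->].
by move: f; rewrite pB => f; rewrite arrow_vB; have [_ fc] := falgP f; rewrite !fc.
Qed.

(** Only composites through the rotated arrow need an argument: before it, scalars are fixed by
    conjugation ([rotc]); after it, the rotation is trivial at [1] ([rot1c]). *)
Lemma arrow_comp p q r f t : (p <= q)%O -> (q <= r)%O -> vertex p f ->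
  arrow p r f t = arrow q r (arrow p q f) t.
Proof.
have rotc x : twist (@rot R) id (const_dmx x x) t = const_dmx x x t.
  have -> : const_dmx x x = (fun=> x%:M) :> (R -> 'M[C]_2).
    by apply/funext => s; apply: mx2P; rewrite !mxE.
  by rewrite /twist scalar_mxC -mulmxA rot_unitary mulmx1.
have rot1c (h : R -> 'M[C]_2) : twist (@rot R) id h 1 = h 1.
  by rewrite /twist rot1 adjm1 mul1mx mulmx1.
move=> pq qr fP.
have [->|rB] := eqVneq r vB.
  rewrite !arrow_vB; have [->|qB] := eqVneq q vB; first by rewrite arrow_vB.
  have [/andP[/eqP -> /eqP ->]|pq'] := boolP ((p == vA1) && (q == vB2)).
    by rewrite arrow_vA1_vB2 rot1c.
  by rewrite (arrow_incl f qB pq').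
have qB : q != vB.
  by apply: contraNneq rB => qB; move: qr; rewrite qB; case: (r) => [[[] []] []].
have [/andP[/eqP q1 /eqP r2]|qr'] := boolP ((q == vA1) && (r == vB2)); last first.
  rewrite (arrow_incl (arrow p q f) rB qr').
  have [/andP[/eqP p1 /eqP q2]|pq'] := boolP ((p == vA1) && (q == vB2)).
    have -> : r = vB2 by move: qr rB; rewrite q2; case: (r) => [[[] []] []].
    by rewrite p1 q2.
  (* No vertex lies strictly between [vA1] and [vB2]. *)
  have [/andP[/eqP p1 /eqP r2]|pr'] := boolP ((p == vA1) && (r == vB2)).
    move: pq qr pq' qr'; rewrite p1 r2 => pq qr pq' qr'; exfalso.
    by move: (q) pq qr pq' qr' => [[[] []] []].
  by rewrite !arrow_incl.
move: pq fP; rewrite q1 r2 (arrow_incl (q := vA1)) ?andbF// arrow_vA1_vB2.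
have [->|p1] := eqVneq p vA1; first by rewrite arrow_vA1_vB2.
rewrite arrow_incl ?(negPf p1)//; move: p1; case: (p) => [[[] []] []] // _ _.
by move=> /scalar_dmx[x ->]; rewrite rotc.
Qed.

Lemma arrow_hom_comp p q r (pq : (p <= q)%O) (qr : (q <= r)%O) (pr : (p <= r)%O) f :
  arrow_hom pr f = arrow_hom qr (arrow_hom pq f).
Proof. by apply: falg_eq => t; exact: arrow_comp pq qr (falgP f). Qed.

Definition cube_diagram : cstar_diagram R cube :=
  CStarDiagram arrow_id arrow_hom_comp.

Definition psi (p : cube) : Du_ob p -> V (cring (falg (vertex p))) :=
  match p with
  | vA => fun n => V_unit _ *+ n
  | vB => fun n => V_elt (elt1 _) *+ n
  | _ => fun x => V_elt (elt1 _) *+ x.1 + V_elt (elt2 _) *+ x.2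
  end.

Lemma vertex_const_dmx p : p != vA -> forall x y, vertex p (const_dmx x y).
Proof.
case: p => [[[] []] []] // _ x y.
all: by [exact: full_const_dmx|exact: path_const_dmx|exact: diag_const_dmx].
Qed.

Lemma psi_morph p : nmod_morphism (@psi p).
Proof.
have h (W : nmodType) (u v : W) :
    nmod_morphism (fun x : nat * nat => u *+ x.1 + v *+ x.2).
  split=> [|x y] /=; first by rewrite !mulr0n addr0.
  by rewrite !mulrnDr addrACA.
have k (W : nmodType) (u : W) : nmod_morphism (fun n : nat => u *+ n).
  by split=> // m n; exact: mulrnDr.
by case: p => [[[] []] []]; [exact: k|exact: h..|exact: k].
Qed.

(** The unit is the sum of the two diagonal idempotents; at [vB] these are equivalent, whence the
    order-unit 2. *)
Lemma psi_unit p : psi (ou_unit (Du_ob p)) = V_unit (cring (falg (vertex p))).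
Proof.
have [->|pA] := eqVneq p vA; first exact: mulr1n.
have := V_elt12 (vertex_const_dmx pA).
case: p {pA} => [[[] []] []] //= <-; rewrite ?mulr1n //.
by rewrite mulr2n {2}V_full_elt12.
Qed.

Lemma psi_bij p : bijective (@psi p).
Proof.
apply: surj_inj_bij.
  case: p => [[[] []] []].
  - exact: V_elt1_inj (full_const_dmx (R:=R)).
  - by apply: V_elt12_inj (path_const_dmx (R:=R)) _ => f [].
  - by apply: V_elt12_inj (diag_const_dmx (R:=R)) _ => f [].
  - by apply: V_elt12_inj (diag_const_dmx (R:=R)) _ => f [].
  - by apply: V_elt12_inj (diag_const_dmx (R:=R)) _ => f [].
  - by apply: V_elt12_inj (diag_const_dmx (R:=R)) _ => f [].
  - by apply: V_elt12_inj (diag_const_dmx (R:=R)) _ => f [].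
  - exact: V_unit_inj.
have pairs (W : nmodType) (u v w : W) : (exists m n, w = u *+ m + v *+ n) ->
    exists x : nat * nat, w = u *+ x.1 + v *+ x.2.
  by move=> [m [n ->]]; exists (m, n).
case: p => [[[] []] []] w; [exact: V_full_surj|..|exact: V_scalar_surj];
  apply: pairs; by [exact: V_path_surj|exact: V_diag_surj].
Qed.

(** The quarter turn and [delta_mx a b] are both off-diagonal, so their product at [0] is
    diagonal. *)
Lemma rot_delta_path (a b : 'I_2) : a != b ->
  path_pred R (fun t => rot t *m delta_mx a b).
Proof.
move=> ab; have [r0 r1] := rot0 R.
split=> [||t t0|t t1].
- exists ((rot 0 *m delta_mx a b) 0 0), ((rot 0 *m delta_mx a b) 1 1).
  by apply: dmxP; rewrite mul2E ?r0 ?r1;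
    move: ab; case: (ord2P a) => ->; case: (ord2P b) => -> // _;
    rewrite !mxE /= !(mulr0, mul0r, addr0).
- apply: mxcontM; [exact: rot_cont|exact: mxcont_cst].
- by rewrite rot_le0.
- by rewrite rot_ge1.
Qed.

Lemma delta_const_dmx : (const_dmx 1 0 : R -> 'M[C]_2) = (fun=> delta_mx 0 0) /\
  (const_dmx 0 1 : R -> 'M[C]_2) = (fun=> delta_mx 1 1).
Proof. by split; apply/funext => t; apply: mx2P; rewrite !mxE. Qed.

(** With [x = rot t *m delta_mx a b], the rotated idempotent is [x x^*] and [delta_mx b b] is
    [x^* x]. *)
Lemma V_rot_delta (a b : 'I_2) : a != b ->
  path_pred R (twist (@rot R) id (fun=> delta_mx a a)) ->
  path_pred R (fun=> delta_mx b b) ->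
  V_elt (felt (path_pred R) (twist (@rot R) id (fun=> delta_mx a a))) =
  V_elt (felt (path_pred R) (fun=> delta_mx b b)).
Proof.
move=> ab Pa Pb.
have Px := rot_delta_path ab; have Py := cp_adj Px.
have rV t (N : 'M[C]_2) : adjm (rot t) *m (rot t *m N) = N.
  by rewrite mulmxA rotV mul1mx.
have adjd : adjm (delta_mx a b : 'M[C]_2) = delta_mx b a.
  by apply/matrixP => i j; rewrite !mxE andbC; case: (_ && _); rewrite ?rmorph0 ?rmorph1.
apply: (V_felt_equiv Pa Pb Px Py) => t.
- by rewrite /twist -!mulmxA rV !(mulmxA (delta_mx a a)) !mul_delta_mx.
- by rewrite mul_delta_mx.
- by rewrite adjmM adjd !mulmxA -(mulmxA (rot t)) mul_delta_mx.
- by rewrite adjmM adjd -mulmxA rV mul_delta_mx.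
Qed.

Lemma V_rot_elt :
  V_elt (felt (path_pred R) (twist (@rot R) id (const_dmx 1 0))) = V_elt (elt2 _) /\
  V_elt (felt (path_pred R) (twist (@rot R) id (const_dmx 0 1))) = V_elt (elt1 _).
Proof.
have [d0 d1] := delta_const_dmx.
have P0 := twist_rot_path 1 0; have P1 := twist_rot_path 0 1.
have Q0 := path_const_dmx (R := R) 1 0; have Q1 := path_const_dmx (R := R) 0 1.
rewrite /elt1 /elt2; rewrite d0 in P0 Q0 *; rewrite d1 in P1 Q1 *.
by split; exact: V_rot_delta.
Qed.

Lemma V_map_psi p q (pq : (p <= q)%O) m n : p != vA ->
  V_map (cring_hom (arrow_hom pq)) (V_elt (elt1 _) *+ m + V_elt (elt2 _) *+ n) =
  V_elt (felt (vertex q) (arrow p q (const_dmx 1 0))) *+ m +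
  V_elt (felt (vertex q) (arrow p q (const_dmx 0 1))) *+ n.
Proof.
move=> pA; have Pd := vertex_const_dmx pA.
rewrite (V_map_morph (cring_hom (arrow_hom pq))).2 !V_mapMn.
by rewrite /elt1 /elt2 !V_twist_felt //; apply: const_dmx_idem;
  rewrite ?mulr1 ?mulr0.
Qed.

(** From [vA] this is preservation of units; into [vB] the two diagonal classes merge, giving
    [hmap]; the rotated arrow gives [smap]; the other arrows fix both classes. *)
Lemma psi_natural p q (pq : (p <= q)%O) (x : Du_ob p) :
  psi (Du_map pq x) = V_map (cring_hom (arrow_hom pq)) (psi x).
Proof.
have [pA|pA] := eqVneq p vA.
  subst p; rewrite [psi x]/(V_unit _ *+ (x : nat)) V_mapMn V_map_unit.
  rewrite -psi_unit; case: q pq => [[[] []] []] pq /=;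
    try by rewrite !mulr1n -?mulrnDl.
  by rewrite -mulrnA mul2n -addnn.
have [qB|qB] := eqVneq q vB.
  subst q.
  have h m n : V_map (cring_hom (arrow_hom pq))
      (V_elt (elt1 _) *+ m + V_elt (elt2 _) *+ n) =
      V_elt (elt1 (vertex vB)) *+ (m + n).
    by rewrite V_map_psi// !arrow_vB mulrnDr; congr (_ + _ *+ _); rewrite V_full_elt12.
  case: p pq x pA h => [[[] []] []] //= pq x _ h; rewrite -?h//.
  (* At [p = vB] the map [psi] has a single coordinate. *)
  by have := h x 0%N; rewrite addn0 mulr0n addr0 => E; exact: esym E.
have [/andP[/eqP p1 /eqP q2]|pq'] := boolP ((p == vA1) && (q == vB2)).
  subst p q; rewrite [psi x]/(_ *+ _ + _ *+ _) V_map_psi// !arrow_vA1_vB2.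
  by rewrite V_rot_elt.1 V_rot_elt.2 addrC.
case: p q pq x pA qB pq' => [[[] []] []] [[[] []] []] // pq x pA qB pq';
  by rewrite [in RHS]/psi V_map_psi// !arrow_incl.
Qed.

End CubeDiagram.

Theorem proposition12p6 (R : realType) :
  exists D : cstar_diagram R cube, ou_diagram_iso (V1_diagram D) Du.
Proof.
exists (cube_diagram R); apply: (@ou_diagram_iso_inv _ _ (V1_diagram (cube_diagram R)) Du (@psi R)).
- exact: psi_morph.
- exact: psi_unit.
- exact: psi_bij.
- exact: psi_natural.
Qed.
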